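(* Let $\mathbb{F}$ be a countable field and let $E$ be a vector space over $\mathbb{F}$ of dimension $\aleph_0$ with a fixed Hamel basis $(e_n)_{n<\omega}$. Then there exists a full mad family $\mathcal{A}\subseteq E^{[\infty]}$ of block subspaces.
   Context: For $x=\sum_n\lambda_n e_n\in E$ let $\mathrm{supp}(x)=\{n:\lambda_n\neq 0\}$; for nonzero $x,y$ write $x<y$ iff $\max\mathrm{supp}(x)<\min\mathrm{supp}(y)$. A block sequence is a $<$-increasing sequence of nonzero vectors; $E^{[\infty]}$ denotes the set of infinite block sequences. For a block sequence $A=(x_n)$ let $\langle A\rangle=\mathrm{span}\{x_n\}$; for $Y\subseteq E$, $\langle Y\rangle=\mathrm{span}(Y)$. A block subspace is a subspace $\langle A\rangle$ with $A\in E^{[\infty]}$ (identified with $A$). For $A,B\in E^{[\infty]}$, $A\le B$ iff $\langle A\rangle\subseteq\langle B\rangle$. Two infinite-dimensional subspaces are almost disjoint if their intersection is finite-dimensional, compatible otherwise; $A,B\in E^{[\infty]}$ are almost disjoint iff $\langle A\rangle,\langle B\rangle$ are. $\mathcal{A}\subseteq E^{[\infty]}$ is almost disjoint if its members are pairwise almost disjoint, and mad if moreover no $B\in E^{[\infty]}$ is almost disjoint from every member of $\mathcal{A}$. A set $Y\subseteq E$ is big if $\langle C\rangle\subseteq Y$ for some $C\in E^{[\infty]}$, small otherwise. For an almost disjoint $\mathcal{A}\subseteq E^{[\infty]}$: $\mathcal{I}^{++}(\mathcal{A})=\{Y\subseteq E:\{A\in\mathcal{A}: Y\cap\langle A\rangle\text{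 is big}\}\text{ is infinite}\}$ and $\mathcal{H}(\mathcal{A})=\{B\in E^{[\infty]}:\langle B\rangle\in\mathcal{I}^{++}(\mathcal{A})\}$. For $\mathcal{H}\subseteq E^{[\infty]}$ and $A\in\mathcal{H}$, $\mathcal{H}\restriction A=\{B\in\mathcal{H}:B\le A\}$. A set $Y\subseteq E$ is $\mathcal{H}$-dense below $A\in\mathcal{H}$ if for every $B\in\mathcal{H}\restriction A$ there is $C\in E^{[\infty]}$ with $C\le B$ and $\langle C\rangle\subseteq Y$. $\mathcal{H}$ is full if whenever $Y\subseteq E$ is $\mathcal{H}$-dense below some $A\in\mathcal{H}$, there is $B\in\mathcal{H}\restriction A$ with $\langle B\rangle\subseteq Y$. A mad family $\mathcal{A}\subseteq E^{[\infty]}$ is full if $\mathcal{H}(\mathcal{A})$ is full. *)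

(* Defs.v *)
From HB Require Import structures.
From mathcomp Require Import all_boot all_order all_algebra.
From mathcomp Require Import boolp classical_sets functions cardinality.

Set Implicit Arguments.
Unset Strict Implicit.
Unset Printing Implicit Defensive.

Import GRing.Theory.
Local Open Scope classical_set_scope.
Local Open Scope ring_scope.

Section BlockSubspaces.
Variables (F : fieldType) (E : lmodType F).

Definition lspan (Y : set E) : set E :=
  [set x | exists (n : nat) (c : 'I_n -> F) (y : 'I_n -> E),
      (forall i, Y (y i)) /\ x = \sum_(i < n) c i *: y i].

Definition lin_indep (e : nat -> E) : Prop :=
  forall (n : nat) (c : 'I_n -> F),
    \sum_(i < n) c i *: e i = 0 -> forall i, c i = 0.

Definition hamel_basis (e : nat -> E) : Prop :=
  lin_indep e /\ lspan (range e) = [set: E].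

(* l is the (finitely supported) coordinate sequence of x in the basis e. *)
Definition expansion (e : nat -> E) (x : E) (l : nat -> F) : Prop :=
  exists N : nat,
    (forall n, (N <= n)%N -> l n = 0) /\ x = \sum_(n < N) l n *: e n.

Definition supp (e : nat -> E) (x : E) : set nat :=
  [set n | exists2 l, expansion e x l & l n != 0].

(* max (supp x) < min (supp y); both extrema exist iff x and y are nonzero. *)
Definition block_lt (e : nat -> E) (x y : E) : Prop :=
  exists m n : nat,
    [/\ supp e x m /\ (forall k, supp e x k -> (k <= m)%N),
        supp e y n /\ (forall k, supp e y k -> (n <= k)%N)
      & (m < n)%N].

(* The set E^[oo] of infinite block sequences. *)
Definition block_seqs (e : nat -> E) : set (nat -> E) :=
  [set A | (forall n, A n != 0)
           /\ (forall m n, (m < n)%N -> block_lt e (A m) (A n))].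

Definition bspan (A : nat -> E) : set E := lspan (range A).

Definition block_le (A B : nat -> E) : Prop := bspan A `<=` bspan B.

(* Meant for linear subspaces V of E. *)
Definition finite_dim (V : set E) : Prop :=
  exists s : seq E, V = lspan [set` s].

Definition almost_disjoint (A B : nat -> E) : Prop :=
  finite_dim (bspan A `&` bspan B).

Definition ad_family (e : nat -> E) (cA : set (nat -> E)) : Prop :=
  cA `<=` block_seqs e
  /\ (forall A B, cA A -> cA B -> A <> B -> almost_disjoint A B).

Definition mad_family (e : nat -> E) (cA : set (nat -> E)) : Prop :=
  ad_family e cA
  /\ ~ (exists2 B, block_seqs e B & forall A, cA A -> almost_disjoint A B).

Definition big (e : nat -> E) (Y : set E) : Prop :=
  exists2 C, block_seqs e C & bspan C `<=` Y.

(* I^{++}(cA) *)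
Definition Ipp (e : nat -> E) (cA : set (nat -> E)) : set (set E) :=
  [set Y | infinite_set [set A | cA A /\ big e (Y `&` bspan A)]].

(* H(cA) *)
Definition Hfam (e : nat -> E) (cA : set (nat -> E)) : set (nat -> E) :=
  [set B | block_seqs e B /\ Ipp e cA (bspan B)].

Definition restr (H : set (nat -> E)) (A : nat -> E) : set (nat -> E) :=
  [set B | H B /\ block_le B A].

Definition dense_below (e : nat -> E) (H : set (nat -> E)) (A : nat -> E)
    (Y : set E) : Prop :=
  forall B, restr H A B ->
    exists C, [/\ block_seqs e C, block_le C B & bspan C `<=` Y].

Definition full (e : nat -> E) (H : set (nat -> E)) : Prop :=
  forall (Y : set E) (A : nat -> E), H A -> dense_below e H A Y ->
    exists2 B, restr H A B & bspan B `<=` Y.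

Definition full_mad_family (e : nat -> E) (cA : set (nat -> E)) : Prop :=
  mad_family e cA /\ full e (Hfam e cA).

End BlockSubspaces.

(* Main.v *)
Require Import Defs.
From HB Require Import structures.
From mathcomp Require Import all_boot all_order all_algebra.
From mathcomp Require Import boolp classical_sets functions cardinality wochoice.
From mathcomp Require Import zify.

Set Implicit Arguments.
Unset Strict Implicit.
Unset Printing Implicit Defensive.

Import GRing.Theory.
Local Open Scope classical_set_scope.

(* The family is built by transfinite recursion over the continuum many pairs
   [(Y, X)] of a set of vectors and a block sequence.  At each stage one looks
   for a block sequence [B <= X] almost disjoint from all members so far, shrinks
   it so that [<B>] lies in [Y] or no block subspace of [<B>] does, and adds
   infinitely many disjoint pieces of [B] to the family.  If no such [B] exists,
   finitely many members already meet every block subspace of [X], and [X] never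
   enters [H(cA)]; otherwise [B] itself is in [H(cA)] below [X] and settles
   fullness for [(Y, X)].  Maximality is immediate.

   The work is to find [B] whenever [X] is positive, i.e. not dominated by
   finitely many members, although there may be many earlier stages.  As in
   Shelah's construction of completely separable families, let [W] be a minimal
   well-order carrying a family of functions [nat -> nat] from which no single
   function is eventually different (its length is non(M)).  Coding finite lists
   by these functions yields sets [S_w] such that any countably many infinite
   sets of naturals are split by one [S_w]; they act on vectors through the
   minimum of the support.  Splitting a positive [X] repeatedly gives continuum
   many branches, and some branch is followed by no earlier stage, so that all
   members compatible with [X] along it are enumerated by a proper initial
   segment of [W] times [nat].  Such a family is not mad below [X]: pick [u] in
   one member and [u'] in another; block vectors [u_p + u'_(q + g n)] avoid the
   whole family as soon as [g] is eventually different from fewer than non(M)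
   functions. *)

(** * Well-orders and eventually different functions *)

Record strict_wo (W : Type) (lt : W -> W -> Prop) : Prop := StrictWo {
  swo_trans : forall x y z, lt x y -> lt y z -> lt x z;
  swo_irr : forall x, ~ lt x x;
  swo_total : forall x y, [\/ lt x y, x = y | lt y x];
  swo_min : forall P : set W, P !=set0 ->
    exists2 w, P w & forall w', P w' -> ~ lt w' w }.

Lemma strict_wo_exists (T : eqType) : exists lt : T -> T -> Prop, strict_wo lt.
Proof.
have [R woR] := well_ordering_principle T.
have ch : wo_chain R predT by move=> A _; exact: woR.
have asym := wo_chain_antisymmetric ch.
have tot : forall x y, R x y || R y x by move=> x y; apply: (wo_chainW ch).
have refl : forall x, R x x by move=> x; apply: (wo_chain_reflexive ch).
have mn : forall P : set T, P !=set0 -> exists2 w, P w & forall w', P w' -> R w w'.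
  move=> P [p Pp]; have /woR[z [[zP zm] _]] : nonempty [pred x | `[< P x >]].
    by exists p; apply/asboolP.
  exists z; first by move: zP => /asboolP.
  by move=> w' Pw'; apply: zm; apply/asboolP.
have tr x y z : ~~ R y x -> ~~ R z y -> ~~ R z x.
  move=> yx zy; apply/negP => zx.
  have [w + wm] : exists2 w, [set x; y; z] w & forall w', [set x; y; z] w' -> R w w'.
    by apply: mn; exists x; left; left.
  case=> [[]|] /= e; subst w.
  - have xz : R x z by apply: wm; right.
    have xyE : x = z by apply: asym => //; rewrite xz zx.
    by subst z; move: (tot x y); rewrite (negbTE yx) (negbTE zy).
  - by move/negP: yx; apply; apply: wm; left; left.
  - by move/negP: zy; apply; apply: wm; left; right.
exists (fun x y => ~~ R y x); split.
- exact: tr.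
- by move=> x; rewrite refl.
- move=> x y; have [yx|yx] := boolP (R y x); last by constructor 1.
  have [xy|xy] := boolP (R x y); last by constructor 3.
  by constructor 2; apply: asym => //; rewrite xy yx.
- move=> P /mn[w Pw wm]; exists w => // w' /wm ww'; by rewrite ww'.
Qed.

(** If some proper initial segment of a well-order of [T] is bad, the least such segment serves;
    otherwise all of [T] does. This stands in for the least cardinal with a property. *)
Lemma minimal_bad_wo (T : eqType) (bad : set T -> Prop) : bad [set: T] ->
  exists (W : Type) (lt : W -> W -> Prop) (i : W -> T),
    [/\ strict_wo lt, injective i, bad (range i)
      & forall w, ~ bad (i @` [set w' | lt w' w])].
Proof.
move=> badT; have [lt wo] := strict_wo_exists T.
have [K [badK segK]] : exists K : set T, bad K /\
    forall t, K t -> ~ bad [set t' | lt t' t] /\ [set t' | lt t' t] `<=` K.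
  have [ex|nex] := pselect (exists t, bad [set t' | lt t' t]); last first.
    exists setT; split=> // t _; split=> // bt; by apply: nex; exists t.
  have [t0 bt0 mt0] := swo_min wo ex.
  exists [set t' | lt t' t0]; split => // t tt0; split; first by move/mt0.
  by move=> t' /= t't; apply: (swo_trans wo) tt0.
exists {t | K t}, (fun a b => lt (sval a) (sval b)), sval; split.
- split.
  + by move=> x y z; apply: (swo_trans wo).
  + by move=> x; apply: (swo_irr wo).
  + move=> [x Kx] [y Ky]; case: (swo_total wo x y) => /= h.
    * by constructor 1.
    * by constructor 2; subst y; congr exist; exact: Prop_irrelevance.
    * by constructor 3.
  + move=> P [[p Kp] Pp].
    have [|w [[w0 Kw0] Pw <-] mw] := swo_min wo (P := sval @` P).
      by exists p; exists (exist _ p Kp).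
    by exists (exist _ w0 Kw0) => // w' Pw'; apply: mw; exists w'.
- by move=> [x Kx] [y Ky] /= e; subst y; congr exist; exact: Prop_irrelevance.
- suff -> : range (sval : {t | K t} -> T) = K by [].
  apply/seteqP; split=> [_ [[x Kx] _ <-]//|x Kx].
  by exists (exist _ x Kx).
- move=> [w Kw] /=; have [nb sK] := segK _ Kw.
  suff -> : (sval : {t | K t} -> T) @` [set w' | lt (sval w') w] =
    [set t' | lt t' w] by [].
  apply/seteqP; split=> [_ [[x Kx] /= ? <-]//|x xw].
  by exists (exist _ x (sK _ xw)).
Qed.

(** [step] receives the earlier values as a total function, with the default [None] outside the
    segment below [w]. *)
Lemma swo_rec (W : Type) (lt : W -> W -> Prop) (V : Type)
    (step : W -> (W -> option V) -> option V) : strict_wo lt ->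
  exists D : W -> option V, forall w,
    D w = step w (fun w' => if pselect (lt w' w) then D w' else None).
Proof.
move=> wo.
have wf : well_founded lt.
  move=> w; apply: contrapT => nw.
  have [u nu mu] := swo_min wo (P := [set w | ~ Acc lt w]) (ex_intro _ w nw).
  by apply: nu; constructor => u' u'u; apply: contrapT => /mu; apply.
pose f w (rec : forall w', lt w' w -> option V) :=
  step w (fun w' => if pselect (lt w' w) is left h then rec w' h else None).
exists (Fix wf (fun _ => option V) f) => w.
rewrite Fix_eq; last first.
  move=> x r1 r2 r12; rewrite /f; congr step; apply: funext => y.
  by case: pselect.
by rewrite /f; congr step; apply: funext => y; case: pselect.
Qed.

(** By Bartoszynski's characterization, this says that the cardinality of [P] is below non(M). *)
Definition evdiff_small (T : Type) (P : set T) : Prop :=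
  forall f : T -> nat -> nat, exists g : nat -> nat,
    forall t, P t -> exists N, forall n, N <= n -> g n <> f t n.

(** The value [g x] codes a table with one entry of an eventually different function [G] for each
    [m] in [cs x]. A correct guess [b t m x] would predict its own entry of the table, which happens
    at finitely many places only. *)
Lemma evdiff_slalom (T I : Type) (P : set T) (code : I -> nat)
    (cs : I -> seq nat) (b : T -> nat -> I -> nat) :
  injective code -> evdiff_small P ->
  exists g : I -> nat, forall t, P t -> exists N,
    forall x m, m \in cs x -> g x = b t m x -> code x < N.
Proof.
move=> cinj sm.
have [dec decK] : exists dec : nat -> option I, forall x, dec (code x) = Some x.
  exists (fun c => if pselect (exists x, code x = c) is left h
                   then Some (sval (cid h)) else None) => x.
  case: pselect => [h|]; last by case; exists x.
  by congr Some; apply: cinj; case: (cid h).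
pose tab n : seq nat := odflt [::] (unpickle n).
pose f t k : nat := if unpickle k is Some (c, m) then
    if dec c is Some x then nth 0 (tab (b t m x)) (index m (cs x)) else 0
  else 0.
have [G Gf] := sm f.
exists (fun x => pickle [seq G (pickle (code x, m)) | m <- cs x]) => t Pt.
have [N GN] := Gf _ Pt.
have [N' N'P] : exists N', forall c m : nat, pickle (c, m) < N -> c < N'.
  exists (\max_(k < N) if unpickle k is Some p then (p : nat * nat).1 else 0).+1.
  move=> c m lt; rewrite ltnS.
  apply: (bigmax_sup (Ordinal lt)) => //=.
  by rewrite pickleK.
exists N' => x m mx e; apply: (N'P (code x) m); rewrite ltnNge; apply/negP => le.
apply: (GN _ le); rewrite /f pickleK decK /tab -e pickleK /=.
by rewrite (nth_map 0) ?index_mem // nth_index.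
Qed.

(* [splen n] bounds the total length of the first [n] lists coded by a
   function: list number [n] is read off up to a length that suffices to offer
   [(splen n).+1] fresh candidates for each side of each of [n.+1] sets. *)
Fixpoint splen n := if n is n'.+1 then splen n' + 2 * n * (splen n').+1 else 0.
Definition splist (f : nat -> nat) n : seq nat :=
  take (2 * n.+1 * (splen n).+1) (odflt [::] (unpickle (f n))).
Definition spset (f : nat -> nat) : set nat := [set x | exists n,
  [/\ x \in splist f n, forall i, i < n -> x \notin splist f i
    & odd (index x (splist f n))]].

(** Let [g n] code a long list of points of the first [n.+1] sets; some [F w] agrees with [g]
    infinitely often. At such an [n] the parity of the position decides membership in [spset],
    except for points of earlier lists, and these are too few to exhaust the candidates. *)
Lemma spset_splits (W : Type) (F : W -> nat -> nat) (M : nat -> set nat) :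
  (forall g : nat -> nat, exists w, forall N, exists2 n, N <= n & g n = F w n) ->
  (forall k N, exists2 x, N <= x & M k x) ->
  exists w, forall k N (l : bool), exists x,
    [/\ N <= x, M k x & spset (F w) x <-> l].
Proof.
move=> Funb Minf.
have [nx nxP] : exists nx : nat -> nat -> nat, forall k N, N <= nx k N /\ M k (nx k N).
  exists (fun k N => sval (cid2 (Minf k N))) => k N.
  by case: cid2.
(* Positions 2j and 2j+1 draw from the same set, and j runs cyclically through the sets 0 to [n], so
   each set occurs at both parities. *)
pose kk n t := t./2 %% n.+1.
pose pt n := fix pt t := if t is t'.+1 then nx (kk n t) (pt t').+1 else nx (kk n 0) n.
have pt_lt n t : pt n t < pt n t.+1 by case: (nxP (kk n t.+1) (pt n t).+1).
have pt_mono n : {homo pt n : s t / s < t} by apply: homo_ltn; [exact: ltn_trans|exact: pt_lt].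
have pt_ge n t : n <= pt n t.
  by elim: t => [|t IH]; [case: (nxP (kk n 0) n)|exact: leq_trans IH (ltnW (pt_lt _ _))].
have ptM n t : M (kk n t) (pt n t) by case: t => [|t]; apply: (nxP _ _).2.
have pt_inj n : injective (pt n).
  move=> s t e; case: (ltngtP s t) => // /(pt_mono n); by rewrite e ltnn.
pose b n := 2 * n.+1 * (splen n).+1.
have [w wP] := Funb (fun n => pickle [seq pt n t | t <- iota 0 (b n)]).
exists w => k N l.
have [n nge e] := wP (maxn N k).
have lstE : splist (F w) n = [seq pt n t | t <- iota 0 (b n)].
  by rewrite /splist -e pickleK /= take_oversize // size_map size_iota.
have prevsz m : size (flatten [seq splist (F w) i | i <- iota 0 m]) <= splen m.
  elim: m => [|m IH] //.
  rewrite -addn1 iotaD map_cat flatten_cat size_cat /= cats0 add0n addn1 /= leq_add //.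
  by rewrite size_take; case: ltnP.
(* Positions of parity [l] assigned to [M k]; one more than [splen n] of them outnumber all earlier
   entries. *)
pose idx i := (i * n.+1 + k) * 2 + l.
pose cand := [seq pt n (idx i) | i <- iota 0 (splen n).+1].
have kn : k <= n by apply: leq_trans nge; rewrite leq_maxr.
have idx_inj : injective idx by rewrite /idx => i j; nia.
have cu : uniq cand.
  rewrite map_inj_in_uniq ?iota_uniq // => i j _ _ /pt_inj; exact: idx_inj.
have [x xc xn] : exists2 x, x \in cand & x \notin flatten [seq splist (F w) i | i <- iota 0 n].
  apply: contrapT => H.
  have /(uniq_leq_size cu) : {subset cand <= flatten [seq splist (F w) i | i <- iota 0 n]}.
    by move=> x xc; apply: contrapT => /negP xn; apply: H; exists x.
  rewrite size_map size_iota => le; have := leq_trans le (prevsz n); by rewrite ltnn.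
have /mapP[i] := xc; rewrite mem_iota add0n /= => ilt xE.
have tb : idx i < b n.
  rewrite /idx /b; case: (l) => /=; nia.
have first j : j < n -> x \notin splist (F w) j.
  move=> jn; apply/negP => xj; move/negP: xn; apply.
  by apply/flattenP; exists (splist (F w) j) => //; apply/mapP; exists j; rewrite // mem_iota.
have xin : x \in splist (F w) n by rewrite lstE xE map_f // mem_iota.
have ix : index x (splist (F w) n) = idx i.
  by rewrite lstE xE index_map // -[X in index X]add0n -(nth_iota 0 0 tb) index_uniq ?size_iota ?iota_uniq.
have oi : odd (idx i) = l by rewrite /idx oddD oddM andbF addFb; case: (l).
exists x; split.
- by rewrite xE (leq_trans _ (pt_ge _ _)) // (leq_trans _ nge) // leq_maxl.
- rewrite xE; suff <- : kk n (idx i) = k by exact: ptM.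
  rewrite /kk /idx addnC muln2 halfD odd_double andbF add0n doubleK.
  have -> : l./2 = 0 by case: (l).
  by rewrite add0n modnMDl modn_small.
- split=> [[m [xm mfirst]]|lt].
  + have -> : m = n.
      case: (ltngtP m n) => // [/first|/mfirst]; by rewrite ?xm ?xin.
    by rewrite ix oi.
  + by exists n; split=> //; rewrite ix oi.
Qed.

(** The family of all functions is bad, since no function differs from itself; minimality then makes
    proper initial segments small. *)
Lemma evdiff_wo : exists (W : Type) (lt : W -> W -> Prop) (F : W -> nat -> nat),
  [/\ strict_wo lt,
      forall g : nat -> nat, exists w, forall N, exists2 n, N <= n & g n = F w n
    & forall w, evdiff_small [set w' | lt w' w]].
Proof.
have [|W [lt [i [wo inj bad nbad]]]] :=
    @minimal_bad_wo (nat -> nat) (fun P => ~ evdiff_small P).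
  by move=> /(_ id)[g /(_ g I)[N /(_ _ (leqnn N))]].
have [F FP] : exists F : (nat -> nat) -> nat -> nat, forall g,
    ~ (forall t, range i t -> exists N, forall n, N <= n -> g n <> F t n).
  by apply: contrapT => /forallNP H; apply: bad => f; apply: contrapT => /forallNP H'; apply: (H f).
exists W, lt, (fun w => F (i w)); split=> //.
- move=> g; apply: contrapT => /forallNP H; apply: (FP g) => _ [w _ <-].
  apply: contrapT => /forallNP H'; apply: (H w) => N.
  apply: contrapT => H2; apply: (H' N) => n Nn e; apply: H2; by exists n.
- move=> w f.
  have [f' f'P] : exists f' : (nat -> nat) -> nat -> nat, forall w, f' (i w) = f w.
    exists (fun t => if pselect (exists w, i w = t) is left h then f (sval (cid h)) else f w) => v.
    case: pselect => [h|]; last by case; exists v.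
    by congr f; apply: inj; case: (cid h).
  have /contrapT sm := nbad w.
  have [g gP] := sm f'.
  exists g => v vw; have [|N NP] := gP (i v); first by exists v.
  by exists N; rewrite -f'P.
Qed.

(** * Linearly closed sets *)

Section LinearClosed.
Local Open Scope ring_scope.
Variables (F : fieldType) (E : lmodType F).
Implicit Types (V W Y : set E) (B : nat -> E) (h : seq E).

Definition lclosed V := V 0 /\ forall a x y, V x -> V y -> V (a *: x + y).

Lemma lclosedD V x y : lclosed V -> V x -> V y -> V (x + y).
Proof. by move=> [_ cV] Vx Vy; rewrite -[x]scale1r; apply: cV. Qed.

Lemma lclosedZ V a x : lclosed V -> V x -> V (a *: x).
Proof. by move=> [V0 cV] Vx; rewrite -[a *: x]addr0; apply: cV. Qed.

Lemma lclosedB V x y : lclosed V -> V x -> V y -> V (x - y).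
Proof. by move=> cV Vx Vy; rewrite -scaleN1r; apply: lclosedD => //; apply: lclosedZ. Qed.

Lemma lclosed_sum V n (c : 'I_n -> F) (y : 'I_n -> E) :
  lclosed V -> (forall i, V (y i)) -> V (\sum_(i < n) c i *: y i).
Proof.
move=> cV Vy; apply: (big_ind V); first exact: cV.1.
- by move=> ? ?; apply: lclosedD.
- by move=> i _; apply: lclosedZ.
Qed.

Lemma lclosedI V W : lclosed V -> lclosed W -> lclosed (V `&` W).
Proof.
move=> [V0 cV] [W0 cW]; split=> // a x y [Vx Wx] [Vy Wy].
by split; [apply: cV|apply: cW].
Qed.

Lemma lspan_closed Y : lclosed (lspan Y).
Proof.
split; first by exists 0%N, (fun=> 0), (fun=> 0); split=> [[]//|]; rewrite big_ord0.
move=> a x y [n [c [u [Yu ->]]]] [m [d [v [Yv ->]]]].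
exists (n + m)%N, (fun i => match fintype.split i with inl i => a * c i | inr i => d i end),
  (fun i => match fintype.split i with inl i => u i | inr i => v i end).
split; first by move=> i; case: fintype.split.
rewrite big_split_ord scaler_sumr /=; congr (_ + _); apply: eq_bigr => i _.
- by rewrite (unsplitK (inl i)) scalerA.
- by rewrite (unsplitK (inr i)).
Qed.

Lemma sub_lspan Y : Y `<=` lspan Y.
Proof.
move=> x Yx; exists 1%N, (fun=> 1), (fun=> x); split => //.
by rewrite big_ord1 scale1r.
Qed.

Lemma lspan_min Y V : lclosed V -> Y `<=` V -> lspan Y `<=` V.
Proof. by move=> cV YV _ [n [c [y [Yy ->]]]]; apply: lclosed_sum => // i; apply: YV. Qed.

Lemma bspan_closed B : lclosed (bspan B).
Proof. exact: lspan_closed. Qed.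

Lemma bspan_term B n : bspan B (B n).
Proof. by apply: sub_lspan; exists n. Qed.

Lemma bspan_min B V : lclosed V -> (forall n, V (B n)) -> bspan B `<=` V.
Proof. by move=> cV VB; apply: lspan_min => // _ [n _ <-]. Qed.

Lemma bspan_sub B (phi : nat -> nat) : bspan (fun n => B (phi n)) `<=` bspan B.
Proof. by apply: bspan_min; [exact: bspan_closed|move=> n; exact: bspan_term]. Qed.

Lemma sum_ord_widen n m (c : nat -> F) B : (n <= m)%N ->
  \sum_(i < n) c i *: B i = \sum_(i < m) (if (i < n)%N then c i else 0) *: B i.
Proof.
move=> nm; rewrite (big_ord_widen _ (fun i => c i *: B i) nm) big_mkcond.
by apply: eq_bigr => i _; case: ifP; rewrite ?scale0r.
Qed.

Lemma bspanP B x : bspan B x -> exists n (c : nat -> F), x = \sum_(i < n) c i *: B i.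
Proof.
apply: (bspan_min (V := [set x | exists n (c : nat -> F), x = \sum_(i < n) c i *: B i])).
- split; first by exists 0%N, (fun=> 0); rewrite big_ord0.
  move=> a u v [n [c ->]] [m [d ->]].
  rewrite (@sum_ord_widen n (maxn n m)) ?leq_maxl // (@sum_ord_widen m (maxn n m)) ?leq_maxr //.
  exists (maxn n m), (fun i => a * (if (i < n)%N then c i else 0) + (if (i < m)%N then d i else 0)).
  rewrite scaler_sumr -big_split /=; apply: eq_bigr => i _.
  by rewrite scalerDl scalerA.
- move=> n; exists n.+1, (fun i => (i == n)%:R).
  rewrite big_ord_recr /= eqxx scale1r big1 ?add0r // => i _.
  by rewrite ltn_eqF ?scale0r.
Qed.

(* [adjoins V h] is [span h + V]. *)
Definition adjoin1 V v : set E := [set x | exists a : F, V (x - a *: v)].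
Definition adjoins V h : set E := foldr (fun v V => adjoin1 V v) V h.

Lemma adjoin1_closed V v : lclosed V -> lclosed (adjoin1 V v).
Proof.
move=> cV; split; first by exists 0; rewrite scale0r subr0; exact: cV.1.
move=> a x y [b Vb] [c Vc]; exists (a * b + c).
suff -> : a *: x + y - (a * b + c) *: v = a *: (x - b *: v) + (y - c *: v) by apply: cV.2.
by rewrite scalerBr scalerDl scalerA opprD addrACA.
Qed.

Lemma adjoins_closed V h : lclosed V -> lclosed (adjoins V h).
Proof. by move=> cV; elim: h => //= v h; apply: adjoin1_closed. Qed.

Lemma adjoins_mkseq V B n (c : nat -> F) z :
  V (z + \sum_(i < n) c i *: B i) -> adjoins V (mkseq B n) z.
Proof.
elim: n V z => [|n IH] V z; first by rewrite big_ord0 addr0.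
rewrite big_ord_recr addrA => Vz.
rewrite mkseqS /adjoins foldr_rcons; apply: IH; exists (- c n).
by rewrite scaleNr opprK.
Qed.

(** Linear independence modulo [V] of the [c j] with [j] outside the exceptional list [J]. *)
Definition indep_mod V (c : nat -> E) (J : seq nat) :=
  forall n (l : nat -> F), (forall j, j \in J -> l j = 0) ->
    V (\sum_(j < n) l j *: c j) -> forall j, (j < n)%N -> l j = 0.

(** One new vector costs one index. Take [j0] in the support of a dependence modulo V + span(v); a
    second dependence with coefficient 0 at [j0] combines with it to cancel [v], and turns out to be
    trivial. *)
Lemma indep_mod_adjoin1 V (c : nat -> E) J v : lclosed V -> indep_mod V c J ->
  exists j0, indep_mod (adjoin1 V v) c (j0 :: J).
Proof.
move=> cV ind.
have [ind'|nind] := pselect (indep_mod (adjoin1 V v) c J).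
  exists 0%N => n l lJ; apply: ind' => j jJ; apply: lJ; by rewrite inE jJ orbT.
have [n [l [lJ [[a Va] [j0 [j0n lj0]]]]]] : exists n l, (forall j, j \in J -> l j = 0) /\
    (adjoin1 V v (\sum_(j < n) l j *: c j) /\ exists j0, (j0 < n)%N /\ l j0 <> 0).
  apply: contrapT => H; apply: nind => n l lJ Vs j jn; apply: contrapT => lj.
  by apply: H; exists n, l; split => //; split => //; exists j.
exists j0 => m k kJ [b Vb].
have kJ' j : j \in J -> k j = 0 by move=> jJ; apply: kJ; rewrite inE jJ orbT.
have kj0 : k j0 = 0 by apply: kJ; rewrite mem_head.
pose M := maxn m n.
(* This combination eliminates [v]; its coefficient at [j0] is [- (b * l j0)], whose vanishing
   forces [b = 0]. *)
pose r j := a * (if (j < m)%N then k j else 0) - b * (if (j < n)%N then l j else 0).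
have Vr : V (\sum_(j < M) r j *: c j).
  have -> : \sum_(j < M) r j *: c j = a *: (\sum_(j < m) k j *: c j) - b *: (\sum_(j < n) l j *: c j).
    rewrite (@sum_ord_widen m M) ?leq_maxl // (@sum_ord_widen n M) ?leq_maxr // !scaler_sumr -sumrB.
    by apply: eq_bigr => j _; rewrite !scalerA -scalerBl.
  rewrite -[X in V X](_ : a *: (\sum_(j < m) k j *: c j - b *: v) - b *: (\sum_(j < n) l j *: c j - a *: v) = _).
    by apply: lclosedB => //; apply: lclosedZ.
  by rewrite !scalerBr !scalerA [b * a]mulrC opprB addrA addrNK.
have r0 j : (j < M)%N -> r j = 0.
  move=> jM; apply: (ind M r) => // i iJ; rewrite /r.
  by rewrite kJ' // lJ // !if_same !mulr0 subrr.
have b0 : b = 0.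
  have := r0 j0; rewrite /r kj0 if_same mulr0 j0n sub0r => /(_ _)/eqP.
  rewrite oppr_eq0 mulf_eq0 => /(_ _)/orP[|/eqP|/eqP//].
    by rewrite (leq_trans j0n) ?leq_maxr.
  by [].
move=> j jm; apply: (ind m k) => //; move: Vb.
by rewrite b0 scale0r subr0.
Qed.

Lemma indep_mod_adjoins V (c : nat -> E) h : lclosed V -> indep_mod V c [::] ->
  exists2 J, size J = size h & indep_mod (adjoins V h) c J.
Proof.
move=> cV ind; elim: h => [|v h [J sJ indJ]]; first by exists [::].
have [j0 indj0] := indep_mod_adjoin1 v (adjoins_closed h cV) indJ.
by exists (j0 :: J); rewrite //= sJ.
Qed.

Lemma indep_mod_notin V (c : nat -> E) J j : indep_mod V c J -> j \notin J -> ~ V (c j).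
Proof.
move=> ind jJ Vj.
have := ind j.+1 (fun i => (i == j)%:R) _ _ j (ltnSn j).
rewrite eqxx => H; suff /eqP : (1 : F) = 0 by rewrite oner_eq0.
apply: H.
- by move=> i iJ; case: eqP => // e; move: iJ; rewrite e (negbTE jJ).
- rewrite big_ord_recr /= eqxx scale1r big1 ?add0r // => i _.
  by rewrite ltn_eqF ?scale0r.
Qed.

End LinearClosed.

(** * Supports and block sequences *)

Record coordinates (F : fieldType) (E : lmodType F) (co : E -> nat -> F) : Prop :=
  Coordinates {
  co_lin : forall a x y n, co (a *: x + y)%R n = (a * co x n + co y n)%R;
  co_fin : forall x, exists N, forall n, N <= n -> co x n = 0%R;
  co_inj : forall x, (forall n, co x n = 0%R) -> x = 0%R }.

Section Blocks.
Variables (F : fieldType) (E : lmodType F) (co : E -> nat -> F).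
Hypothesis coP : coordinates co.
Implicit Types (V W Y : set E) (A B D : nat -> E) (h : seq E) (x y z : E).

Lemma co0 n : co 0%R n = 0%R.
Proof. by have := co_lin coP (-1)%R 0%R 0%R n; rewrite scaler0 addr0 mulN1r addNr. Qed.

Lemma coD x y n : co (x + y)%R n = (co x n + co y n)%R.
Proof. by have := co_lin coP 1%R x y n; rewrite scale1r mul1r. Qed.

Lemma coZ a x n : co (a *: x)%R n = (a * co x n)%R.
Proof. by have := co_lin coP a x 0%R n; rewrite !addr0 co0 addr0. Qed.

Lemma coB x y n : co (x - y)%R n = (co x n - co y n)%R.
Proof. by rewrite coD -scaleN1r coZ mulN1r. Qed.

Lemma co_sum m (c : 'I_m -> F) (y : 'I_m -> E) n :
  co (\sum_(i < m) c i *: y i)%R n = (\sum_(i < m) c i * co (y i) n)%R.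
Proof.
elim/big_rec2: _ => [|i u v _ <-]; first exact: co0.
by rewrite coD coZ.
Qed.

Definition supp_ge N x := forall n, n < N -> co x n = 0%R.
Definition supp_lt N x := forall n, N <= n -> co x n = 0%R.

Lemma supp_ge_closed N : lclosed (supp_ge N).
Proof.
split; first by move=> n _; exact: co0.
by move=> a x y tx ty n nN; rewrite (co_lin coP) tx // ty // mulr0 addr0.
Qed.

Lemma supp_lt_closed N : lclosed (supp_lt N).
Proof.
split; first by move=> n _; exact: co0.
by move=> a x y tx ty n nN; rewrite (co_lin coP) tx // ty // mulr0 addr0.
Qed.

Lemma supp_geW M N x : M <= N -> supp_ge N x -> supp_ge M x.
Proof. by move=> MN tx n nM; apply: tx; apply: leq_trans MN. Qed.

Lemma supp_ltW M N x : M <= N -> supp_lt M x -> supp_lt N x.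
Proof. by move=> MN tx n nM; apply: tx; apply: leq_trans nM. Qed.

Lemma supp_lt_ge0 N x : supp_lt N x -> supp_ge N x -> x = 0%R.
Proof. by move=> hx tx; apply: (co_inj coP) => n; case: (ltnP n N) => [/tx|/hx]. Qed.

Lemma supp_lt_seq h : exists N, forall x, x \in h -> supp_lt N x.
Proof.
elim: h => [|x h [N NP]]; first by exists 0.
have [M MP] := co_fin coP x; exists (maxn M N) => y; rewrite inE => /predU1P[->|/NP].
- exact: supp_ltW (leq_maxl _ _) MP.
- exact: supp_ltW (leq_maxr _ _).
Qed.

(* The minimum of the support, with the junk value [ms 0 = 0]. *)
Definition ms x : nat :=
  if pselect (exists n, co x n != 0%R) is left ex then ex_minn ex else 0.

Lemma msP x : x <> 0%R -> co x (ms x) <> 0%R /\ supp_ge (ms x) x.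
Proof.
move=> x0; rewrite /ms; case: pselect => [ex|nex]; last first.
  case: x0; apply: (co_inj coP) => n; apply: contrapT => /eqP xn.
  by apply: nex; exists n.
case: ex_minnP => n /eqP xn nmin; split => // m mn.
by apply: contrapT => /eqP /nmin; rewrite leqNgt mn.
Qed.

Lemma ms_eq x n : supp_ge n x -> co x n <> 0%R -> ms x = n.
Proof.
move=> tx xn; have x0 : x <> 0%R by move=> e; apply: xn; rewrite e co0.
have [c t] := msP x0; case: (ltngtP (ms x) n) => // [/tx|/t] //.
Qed.

Lemma ms_ge x N : x <> 0%R -> supp_ge N x -> N <= ms x.
Proof. by move=> /msP[c _] tx; rewrite leqNgt; apply/negP => /tx. Qed.

Definition blk B := (forall n, B n <> 0%R) /\
  forall m n, m < n -> exists N, supp_lt N (B m) /\ supp_ge N (B n).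

Lemma blk_supp_ge B m n : blk B -> m < n -> supp_ge (ms (B m)).+1 (B n).
Proof.
move=> [B0 bB] mn; have [N [hN tN]] := bB _ _ mn.
apply: supp_geW tN; have [cm _] := msP (B0 m).
by rewrite ltnNge; apply/negP => /hN.
Qed.

Lemma blk_ms_lt B : blk B -> {homo (fun n => ms (B n)) : m n / m < n}.
Proof. by move=> bB m n mn; apply: ms_ge (blk_supp_ge bB mn); apply: bB.1. Qed.

Lemma blk_ms_le B m n : blk B -> m <= n -> ms (B m) <= ms (B n).
Proof. by move=> bB; rewrite leq_eqVlt => /predU1P[->//|/(blk_ms_lt bB)/ltnW]. Qed.

Lemma blk_ms_ge B n : blk B -> n <= ms (B n).
Proof.
by move=> bB; elim: n => // n IH; apply: leq_ltn_trans IH (blk_ms_lt bB (ltnSn n)).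
Qed.

Lemma blk_supp_ge_id B n : blk B -> supp_ge n (B n).
Proof. by move=> bB; apply: supp_geW (blk_ms_ge n bB) (msP (bB.1 n)).2. Qed.

Lemma blk_sub B (phi : nat -> nat) : blk B -> {homo phi : m n / m < n} ->
  blk (fun n => B (phi n)).
Proof. by move=> [B0 bB] mono; split=> [n|m n mn]; [exact: B0|apply: bB; apply: mono]. Qed.

(** Later terms start beyond [ms (B i)] and earlier ones have coefficient 0, so only summand [i]
    contributes at that coordinate. *)
Lemma blk_lead B m (c : nat -> F) i : blk B -> i < m -> c i <> 0%R ->
  (forall j, j < i -> c j = 0%R) ->
  let x := (\sum_(j < m) c j *: B j)%R in x <> 0%R /\ ms x = ms (B i).
Proof.
move=> bB im ci cj x; have [cB tB] := msP (bB.1 i).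
have tx : supp_ge (ms (B i)) x.
  move=> k kB; rewrite co_sum big1 // => j _.
  case: (ltnP j i) => ji; first by rewrite cj ?mul0r.
  suff -> : co (B j) k = 0%R by rewrite mulr0.
  move: ji; rewrite leq_eqVlt => /predU1P[<-|ji]; first exact: tB.
  by apply: (blk_supp_ge bB ji); apply: ltnW.
have cx : co x (ms (B i)) <> 0%R.
  rewrite co_sum (bigD1 (Ordinal im)) //= big1 ?addr0; last first.
    move=> j /eqP ne; case: (ltngtP j i) => ji.
    - by rewrite cj ?mul0r.
    - by rewrite (blk_supp_ge bB ji) ?mulr0.
    - by case: ne; apply: val_inj.
  by apply/eqP; rewrite mulf_neq0 //; apply/eqP.
split; last exact: ms_eq.
by move=> x0; apply: cx; rewrite x0 co0.
Qed.

Lemma blk_span_ms B x : blk B -> bspan B x -> x <> 0%R -> exists n, ms x = ms (B n).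
Proof.
move=> bB /bspanP[m [c ->]] x0.
have ex : exists i, (i < m) && (c i != 0%R).
  apply: contrapT => H; apply: x0; rewrite big1 // => i _.
  suff -> : c i = 0%R by rewrite scale0r.
  apply: contrapT => /eqP ci; apply: H; exists i; by rewrite ci ltn_ord.
case: (ex_minnP ex) => i /andP[im /eqP ci] imin.
exists i; apply: (blk_lead bB im ci _).2 => j ji; apply: contrapT => /eqP cj.
by have := imin j; rewrite (ltn_trans ji im) cj leqNgt ji => /(_ isT).
Qed.

Lemma blk_indep B m (c : nat -> F) : blk B -> (\sum_(j < m) c j *: B j)%R = 0%R ->
  forall j, j < m -> c j = 0%R.
Proof.
move=> bB s0 j jm; apply: contrapT => /eqP cj.
have ex : exists i, (i < m) && (c i != 0%R) by exists j; rewrite jm.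
case: (ex_minnP ex) => i /andP[im /eqP ci] imin.
apply: (blk_lead bB im ci _).1 s0 => k ki; apply: contrapT => /eqP ck.
by have := imin k; rewrite (ltn_trans ki im) ck leqNgt ki => /(_ isT).
Qed.

Lemma blk_select_next (Q : seq E -> E -> Prop) :
  (forall h, exists x, [/\ x <> 0%R,
     exists N, (forall y, y \in h -> supp_lt N y) /\ supp_ge N x & Q h x]) ->
  exists2 D, blk D & forall n, Q (mkseq D n) (D n).
Proof.
move=> /choice[pick pickP].
pose pre n := iter n (fun h => rcons h (pick h)) [::].
have preE n : mkseq (fun k => pick (pre k)) n = pre n.
  by elim: n => // n IH; rewrite mkseqS IH.
exists (fun n => pick (pre n)); last by move=> n; rewrite preE; case: (pickP (pre n)).
split=> [n|m n mn]; first by case: (pickP (pre n)).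
have [_ [N [hN tN]] _] := pickP (pre n); exists N; split => //; apply: hN.
by rewrite -(preE n); apply/mapP; exists m; rewrite ?mem_iota.
Qed.

Lemma blk_select (Q : seq E -> E -> Prop) :
  (forall h N, exists x, [/\ x <> 0%R, supp_ge N x & Q h x]) ->
  exists2 D, blk D & forall n, Q (mkseq D n) (D n).
Proof.
move=> Qex; apply: blk_select_next => h.
have [N NP] := supp_lt_seq h; have [x [x0 tx Qx]] := Qex h N.
by exists x; split => //; exists N.
Qed.

(** For subspaces this is finite-dimensional intersection ([finite_dimP]): the vectors supported
    from [N] on have finite codimension. *)
Definition ad V W := exists N, forall x, V x -> W x -> supp_ge N x -> x = 0%R.

Lemma adC V W : ad V W -> ad W V.
Proof. by move=> [N NP]; exists N => x Wx Vx; apply: NP. Qed.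

Lemma adS V V' W W' : V' `<=` V -> W' `<=` W -> ad V W -> ad V' W'.
Proof. by move=> VV WW [N NP]; exists N => x /VV Vx /WW Wx; apply: NP. Qed.

Lemma nad_ex V W : ~ ad V W -> forall N, exists x, [/\ x <> 0%R, supp_ge N x, V x & W x].
Proof.
move=> nad N; apply: contrapT => H; apply: nad; exists N => x Vx Wx tx.
by apply: contrapT => x0; apply: H; exists x.
Qed.

Lemma nad_blk V W : ~ ad V W -> exists2 D, blk D & forall n, V (D n) /\ W (D n).
Proof.
move=> nad; have [|D bD DP] := @blk_select (fun _ x => V x /\ W x).
  by move=> _ N; have [x [x0 tx Vx Wx]] := nad_ex nad N; exists x.
by exists D.
Qed.

Lemma blk_nad D V W : blk D -> (forall n, V (D n)) -> (forall n, W (D n)) -> ~ ad V W.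
Proof.
move=> bD VD WD [N /(_ (D N) (VD N) (WD N))H].
by apply: (bD.1 N); apply: H; apply: blk_supp_ge_id.
Qed.

(** If a nonzero [x0] far out lies in [W] and in V + span(v), eliminating [v] makes every other such
    vector a multiple of [x0]; beyond the support of [x0] only 0 is left. *)
Lemma ad_adjoin1 V W v : lclosed V -> lclosed W -> ad V W -> ad (adjoin1 V v) W.
Proof.
move=> cV cW [N NP].
have [[x0 [a [Vx0 Wx0 tx0 x00]]]|H] :=
    pselect (exists x a, [/\ V (x - a *: v)%R, W x, supp_ge N x & x <> 0%R]); last first.
  by exists N => x [a Vx] Wx tx; apply: contrapT => x0; apply: H; exists x, a.
have a0 : a <> 0%R.
  by move=> a0; apply: x00; apply: NP => //; move: Vx0; rewrite a0 scale0r subr0.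
have [M hM] := co_fin coP x0; exists (maxn N M) => x [b Vx] Wx tx.
have xE : (x - (b / a) *: x0)%R = 0%R.
  apply: NP.
  - rewrite -[X in V X](_ : (x - b *: v - (b / a) *: (x0 - a *: v)) = _)%R.
      by apply: lclosedB => //; apply: lclosedZ.
    by rewrite scalerBr scalerA divfK ?opprB ?addrA ?addrNK //; apply/eqP.
  - by apply: lclosedB => //; apply: lclosedZ.
  - apply: (lclosedB (supp_ge_closed N)).
      exact: supp_geW (leq_maxl _ _) tx.
    exact: (lclosedZ _ (supp_ge_closed N)).
apply: (@supp_lt_ge0 (maxn N M)) => //.
move/eqP: xE; rewrite subr_eq0 => /eqP ->; apply: (lclosedZ _ (supp_lt_closed _)).
exact: supp_ltW (leq_maxr _ _) hM.
Qed.

Lemma ad_adjoins V W h : lclosed V -> lclosed W -> ad V W -> ad (adjoins V h) W.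
Proof.
move=> cV cW adVW; elim: h => //= v h IH; apply: ad_adjoin1 => //; exact: adjoins_closed.
Qed.

(** A last nonzero coefficient with index at least [N] would put its [Z n] into [V] plus the span of
    the earlier terms. So the intersection lies in the span of the first [N] terms, whose supports
    are bounded. *)
Lemma ad_of_notin V Z N : blk Z -> lclosed V ->
  (forall n, N <= n -> ~ adjoins V (mkseq Z n) (Z n)) -> ad (bspan Z) V.
Proof.
move=> bZ cV notin.
have [M hM] := supp_lt_seq (mkseq Z N).
exists M => _ /bspanP[n [c ->]] Vx tx; apply: (@supp_lt_ge0 M) => //.
elim: n Vx {tx} => [|n IH]; first by rewrite big_ord0 => _; exact: (supp_lt_closed _).1.
rewrite big_ord_recr /= => Vx.
have [cn0|/eqP cn] := pselect (c n = 0%R).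
  by move: Vx; rewrite cn0 scale0r addr0.
case: (leqP N n) => nN.
  exfalso; apply: (notin n nN).
  apply: (@adjoins_mkseq _ _ _ _ _ (fun i => (c n)^-1 * c i)%R).
  rewrite -[X in V X](_ : (c n)^-1 *: (\sum_(i < n) c i *: Z i + c n *: Z n) = _)%R.
    exact: lclosedZ.
  rewrite scalerDr scalerA mulVf // scale1r addrC scaler_sumr; congr (_ + _)%R.
  by apply: eq_bigr => i _; rewrite scalerA.
have hZ k : k < N -> supp_lt M (Z k).
  by move=> kN; apply: hM; apply/mapP; exists k; rewrite ?mem_iota.
apply: (lclosedD (supp_lt_closed M)).
- by apply: (lclosed_sum _ (supp_lt_closed M)) => i; apply: hZ; apply: ltn_trans nN.
- exact: (lclosedZ _ (supp_lt_closed M) (hZ n nN)).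
Qed.

(** By induction on [N]: the kernel of coordinate [N] has codimension at most one in [V], and inside
    it vanishing below [N] gives vanishing below [N.+1]. *)
Lemma finite_dimP V : lclosed V ->
  finite_dim V <-> exists N, forall x, V x -> supp_ge N x -> x = 0%R.
Proof.
move=> cV; split=> [[s VE]|[N]].
  have [N NP] := supp_lt_seq s; exists N => x; rewrite VE => Vx.
  apply: supp_lt_ge0; move: x Vx; apply: lspan_min; [exact: supp_lt_closed|exact: NP].
elim: N V cV => [|N IH] V cV VN.
  exists [::]; apply/seteqP; split=> x.
    by move=> Vx; rewrite (VN x) //; exact: (lspan_closed _).1.
  by apply: lspan_min.
have [s sP] : finite_dim (V `&` [set x | co x N = 0%R]).
  apply: IH.
    apply: lclosedI => //; split; first exact: co0.
    by move=> a x y /= x0 y0; rewrite (co_lin coP) x0 y0 mulr0 addr0.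
  move=> x [Vx xN] tx; apply: VN => // n; rewrite ltnS leq_eqVlt => /predU1P[->//|].
  exact: tx.
have sV x : x \in s -> V x.
  by move=> xs; suff [] : (V `&` [set x | co x N = 0%R]) x by []; rewrite sP; exact: sub_lspan.
have [[v [Vv vN]]|H] := pselect (exists v, V v /\ co v N <> 0%R); last first.
  exists s; rewrite -sP; apply/seteqP; split=> x; last by case.
  by move=> Vx; split=> //; apply: contrapT => xN; apply: H; exists x.
exists (v :: s); apply/seteqP; split=> x; last first.
  by apply: lspan_min => // y /=; rewrite inE => /predU1P[->|/sV].
move=> Vx; rewrite -(subrK ((co x N / co v N) *: v)%R x).
apply: lclosedD; first exact: lspan_closed.
- have : (V `&` [set x | co x N = 0%R]) (x - (co x N / co v N) *: v)%R.
    split; first by apply: lclosedB => //; apply: lclosedZ.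
    by rewrite /= coB coZ divfK ?subrr //; apply/eqP.
  rewrite sP; apply: lspan_min; first exact: lspan_closed.
  by move=> y ys; apply: sub_lspan; rewrite /= inE ys orbT.
- apply: lclosedZ; first exact: lspan_closed.
  by apply: sub_lspan; rewrite /= mem_head.
Qed.

Lemma almost_disjointP A B : almost_disjoint A B <-> ad (bspan A) (bspan B).
Proof.
rewrite /almost_disjoint finite_dimP; last by apply: lclosedI; exact: bspan_closed.
split=> [[N NP]|[N NP]]; exists N; first by move=> x ? ?; apply: NP.
by move=> x []; apply: NP.
Qed.

End Blocks.

(** * Positivity *)

Lemma increasing_selection (P : nat -> Prop) :
  (forall N, exists2 n, N <= n & P n) ->
  exists2 phi : nat -> nat, {homo phi : m n / m < n} & forall n, P (phi n).
Proof.
move=> Pex.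
have /choice[nx nxP] : forall N, exists n, N <= n /\ P n.
  by move=> N; have [n ? ?] := Pex N; exists n.
pose phi := fix phi n := if n is n'.+1 then nx (phi n').+1 else nx 0.
exists phi; last by case=> [|n]; apply: (nxP _).2.
by apply: homo_ltn; [exact: ltn_trans|move=> n; apply: (nxP _).1].
Qed.

Lemma injective_unbounded (f : nat -> nat) : injective f ->
  forall K, exists N, forall n, N <= n -> K <= f n.
Proof.
move=> finj; elim=> [|K [N NP]]; first by exists 0.
have [[n0 e]|H] := pselect (exists n, f n = K).
  exists (maxn N n0.+1) => n; rewrite geq_max => /andP[/NP Kn n0n].
  rewrite ltn_neqAle Kn andbT; apply/eqP => e'.
  by move: n0n; rewrite (finj n0 n) ?ltnn // e.
exists N => n /NP Kn; rewrite ltn_neqAle Kn andbT; apply/eqP => e.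
by apply: H; exists n.
Qed.

Section Positivity.
Variables (F : fieldType) (E : lmodType F) (co : E -> nat -> F).
Hypothesis coP : coordinates co.
Variable cA : set (nat -> E).
Hypothesis cA_ad : forall A B, cA A -> cA B -> A <> B -> ad co (bspan A) (bspan B).
Implicit Types (X A B D : nat -> E) (T : set nat) (s : seq (nat -> E)).
Local Notation ad := (ad co).
Local Notation ms := (ms co).
Local Notation blk := (blk co).
Local Notation supp_ge := (supp_ge co).
Local Notation supp_lt := (supp_lt co).

(** Constraining minima of supports is stable under block subspaces, as the minimum of a nonzero
    combination of blocks is that of one of them. *)
Definition in_part X T D := blk D /\ forall n, bspan X (D n) /\ T (ms (D n)).

Definition pos X T := forall s, (forall A, A \in s -> cA A) ->
  exists2 D, in_part X T D & forall A, A \in s -> ad (bspan D) (bspan A).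

Lemma blk_sub_ms D D' : blk D -> blk D' -> (forall n, bspan D (D' n)) ->
  forall n, exists2 k, n <= k & ms (D' n) = ms (D k).
Proof.
move=> bD bD' DD'.
have /choice[k kE] : forall n, exists k, ms (D' n) = ms (D k).
  by move=> n; apply: (blk_span_ms coP bD (DD' n)); apply: bD'.1.
have kmono : {homo k : m n / m < n}.
  move=> m n mn; rewrite ltnNge; apply/negP => /(blk_ms_le coP bD).
  by rewrite -!kE leqNgt (blk_ms_lt coP bD' mn).
move=> n; exists (k n) => //.
by elim: n => // n IH; apply: leq_ltn_trans IH (kmono _ _ (ltnSn n)).
Qed.

Lemma bspan_le D D' : (forall n, bspan D (D' n)) -> bspan D' `<=` bspan D.
Proof. by apply: bspan_min; exact: bspan_closed. Qed.

Lemma in_part_sub X T D D' : in_part X T D -> blk D' ->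
  (forall n, bspan D (D' n)) -> in_part X T D'.
Proof.
move=> [bD DP] bD' DD'; split=> // n; split.
  by apply: (bspan_le (D := X)) (DD' n) => k; case: (DP k).
by have [k _ ->] := blk_sub_ms bD bD' DD' n; case: (DP k).
Qed.

(** Unless one [D] is almost disjoint from all of [cA], recursion yields distinct members A_k with
    [Ds k] inside A_k; a finite [s] misses some A_k, and then [Ds k] is almost disjoint from all of
    [s]. Positivity thus needs only countably many witnesses. *)
Lemma witness (Z : (nat -> E) -> Prop) :
  (forall D D', Z D -> blk D -> blk D' -> (forall n, bspan D (D' n)) -> Z D') ->
  (forall s, (forall A, A \in s -> cA A) ->
     exists D, [/\ blk D, Z D & forall A, A \in s -> ad (bspan D) (bspan A)]) ->
  exists Ds : nat -> nat -> E, (forall k, blk (Ds k) /\ Z (Ds k)) /\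
    forall s, (forall A, A \in s -> cA A) ->
      exists k, forall A, A \in s -> ad (bspan (Ds k)) (bspan A).
Proof.
move=> Zher Zex.
have [[D [bD ZD adD]]|H] := pselect (exists D, [/\ blk D, Z D &
    forall A, cA A -> ad (bspan D) (bspan A)]).
  by exists (fun=> D); split=> // s sA; exists 0%N => A /sA; apply: adD.
have /choice[nx nxP] : forall s, exists p : (nat -> E) * (nat -> E),
    (forall A, A \in s -> cA A) ->
    [/\ cA p.1, p.1 \notin s, blk p.2, Z p.2 & forall n, bspan p.1 (p.2 n)].
  move=> s; have [sA|] := pselect (forall A, A \in s -> cA A); last first.
    by move=> ns; exists (0%R, 0%R).
  have [D [bD ZD adD]] := Zex s sA.
  have [A [cAA nad]] : exists A, cA A /\ ~ ad (bspan D) (bspan A).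
    apply: contrapT => H'; apply: H; exists D; split=> // A cAA.
    by apply: contrapT => nad; apply: H'; exists A.
  have [D' bD' D'P] := nad_blk coP nad.
  exists (A, D') => _; split=> //=.
  - by apply/negP => /adD.
  - by apply: Zher ZD bD bD' _ => n; case: (D'P n).
  - by move=> n; case: (D'P n).
pose pre n := iter n (fun s => rcons s (nx s).1) [::].
have preA n : forall A, A \in pre n -> cA A.
  elim: n => // n IH A /=; rewrite mem_rcons inE => /predU1P[->|/IH//].
  by case: (nxP _ IH).
have preU n : uniq (pre n).
  by elim: n => // n IH /=; rewrite rcons_uniq IH; case: (nxP _ (preA n)) => _ ->.
have preS n : size (pre n) = n by elim: n => // n IH /=; rewrite size_rcons IH.
exists (fun n => (nx (pre n)).2); split=> [k|s sA]; first by case: (nxP _ (preA k)).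
have [k ks] : exists k, (nx (pre k)).1 \notin s.
  apply: contrapT => H'.
  have sub n : {subset pre n <= s}.
    elim: n => // n IH A /=; rewrite mem_rcons inE => /predU1P[->|/IH//].
    by apply: contrapT => /negP ns; apply: H'; exists n.
  have := uniq_leq_size (preU (size s).+1) (sub _); by rewrite preS ltnn.
exists k => A As; have [cAk _ _ _ Dk] := nxP _ (preA k).
apply: adS (cA_ad cAk (sA _ As) _) => //; first exact: bspan_le.
by move=> e; move: ks; rewrite e As.
Qed.

Variables (W : Type) (S : W -> set nat).
Hypothesis S_splits : forall M : nat -> set nat,
  (forall k N, exists2 x, N <= x & M k x) ->
  exists w, forall k N (l : bool), exists x, [/\ N <= x, M k x & S w x <-> l].

Definition side w (l : bool) : set nat := [set x | S w x <-> l].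

(** One [w] splits the support minima of all the countably many witnesses at once, so each has
    subsequences on both sides. *)
Lemma pos_split X T : pos X T -> exists w, forall l, pos X (T `&` side w l).
Proof.
move=> pT.
have [||Ds [DsP DsA]] := @witness (fun D => in_part X T D).
- by move=> D D' zD _ bD'; apply: in_part_sub.
- by move=> s /pT[D zD adD]; exists D; split => //; case: zD.
have [|w wP] := S_splits (M := fun k => [set x | exists n, x = ms (Ds k n)]).
  move=> k N; exists (ms (Ds k N)); last by exists N.
  by apply: blk_ms_ge => //; case: (DsP k).
exists w => l s sA; have [k adk] := DsA s sA; have [bD [_ zD]] := DsP k.
have [|phi mono phiP] := @increasing_selection (fun n => S w (ms (Ds k n)) <-> l).
  move=> N; have [x [Nx [n xE] Sx]] := wP k (ms (Ds k N)) l.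
  exists n; last by rewrite -xE.
  rewrite leqNgt; apply/negP => nN; move: Nx.
  by rewrite xE leqNgt (blk_ms_lt coP bD nN).
exists (fun n => Ds k (phi n)).
  split; first exact: blk_sub.
  by move=> n; have [? ?] := zD (phi n); split => //; split=> //; exact: phiP.
by move=> A /adk; apply: adS => //; exact: bspan_sub.
Qed.

Lemma ad_uniform (I : eqType) (s : seq I) (U : I -> set E) (V : set E) :
  (forall i, i \in s -> ad (U i) V) ->
  exists N, forall i, i \in s -> forall x, U i x -> V x -> supp_ge N x -> x = 0%R.
Proof.
elim: s => [|i s IH] H; first by exists 0%N.
have [|N NP] := IH; first by move=> j js; apply: H; rewrite inE js orbT.
have [|M MP] := H i; first by rewrite mem_head.
exists (maxn M N) => j; rewrite inE => /predU1P[->|js] x Ux Vx tx.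
- by apply: MP => //; apply: supp_geW tx; exact: leq_maxl.
- by apply: (NP j) => //; apply: supp_geW tx; exact: leq_maxr.
Qed.

(** For a finite [s], a diagonal sequence takes its [n]-th term from [T n], outside each member of
    [s] plus the span of the earlier terms. Countably many such sequences suffice by [witness], and
    their minima make up [T']. *)
Lemma pos_pseudo_intersection X (T : nat -> set nat) :
  (forall m n, m <= n -> T n `<=` T m) -> (forall n, pos X (T n)) ->
  exists2 T', forall n, exists N, forall x, N <= x -> T' x -> T n x & pos X T'.
Proof.
move=> Tdec pT.
have [||Ds [DsP DsA]] := @witness (fun D => forall n, bspan X (D n) /\ T n (ms (D n))).
- move=> D D' zD bD bD' DD' n; split.
    by apply: (bspan_le (D := X)) (DD' n) => k; case: (zD k).
  by have [k nk ->] := blk_sub_ms bD bD' DD' n; apply: Tdec nk _ _; case: (zD k).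
- move=> s sA.
  have [|Z bZ ZP] := @blk_select _ _ _ coP (fun h x => [/\ bspan X x, T (size h) (ms x)
      & forall A, A \in s -> ~ adjoins (bspan A) h x]).
    move=> h N; have [D [bD DP] adD] := pT (size h) s sA.
    have [|M MP] := @ad_uniform _ s (fun A => adjoins (bspan A) h) (bspan D).
      move=> A As; apply: ad_adjoins => //; try exact: bspan_closed.
      by apply: adC; apply: adD.
    have ge : supp_ge (maxn M N) (D (maxn M N)) by apply: blk_supp_ge_id.
    exists (D (maxn M N)); split; first exact: bD.1.
      by apply: supp_geW ge; exact: leq_maxr.
    have [? ?] := DP (maxn M N); split=> // A As inA.
    apply: (bD.1 (maxn M N)); apply: (MP A As) => //; first exact: bspan_term.
    by apply: supp_geW ge; exact: leq_maxl.
  exists Z; split=> //.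
    by move=> n; have [? + _] := ZP n; rewrite size_mkseq.
  move=> A As; apply: (@ad_of_notin _ _ _ coP _ _ 0%N) => //; first exact: bspan_closed.
  by move=> n _; have [_ _ ZA] := ZP n; apply: ZA.
(* With [k <= m] only finitely many minima come from [m < n], and the others lie in [T n]; dropping
   the first [k] terms of [Ds k] keeps it in the part. *)
exists [set x | exists k m, k <= m /\ x = ms (Ds k m)].
  move=> n; exists (\max_(k < n) \max_(m < n) (ms (Ds k m)).+1) => x + [k [m [km xE]]].
  rewrite xE => le; have [_ zD] := DsP k; have [_] := zD m.
  case: (leqP n m) => [nm|mn]; first exact: Tdec.
  exfalso; move: le; rewrite leqNgt => /negP; apply.
  rewrite (leq_trans _ (leq_bigmax (Ordinal (leq_ltn_trans km mn)))) //.
  by rewrite (leq_trans _ (leq_bigmax (Ordinal mn))).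
move=> s sA; have [k adk] := DsA s sA; have [bD zD] := DsP k.
exists (fun n => Ds k (n + k)).
  split; first by apply: blk_sub => // m n mn; rewrite ltn_add2r.
  move=> n; have [? _] := zD (n + k); split=> //; exists k, (n + k).
  by rewrite leq_addl.
by move=> A /adk; apply: adS => //; exact: bspan_sub.
Qed.

End Positivity.

(** * Families with few members are not mad in a positive part *)

Section NotMad.
Variables (F : fieldType) (E : lmodType F) (co : E -> nat -> F).
Hypothesis coP : coordinates co.
Variable code : E -> nat.
Hypothesis code_inj : injective code.
Variable cA : set (nat -> E).
Hypothesis cA_ad : forall A B, cA A -> cA B -> A <> B -> ad co (bspan A) (bspan B).
Implicit Types (X A B D : nat -> E) (T : set nat) (s : seq (nat -> E)).
Local Notation ad := (ad co).
Local Notation ms := (ms co).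
Local Notation blk := (blk co).
Local Notation supp_ge := (supp_ge co).
Local Notation supp_lt := (supp_lt co).
Local Notation in_part := (in_part co).
Local Notation pos := (pos co cA).

(* The new block sequence is [z_n = u_p + u'_(q + g n)] with [u] in [A0] and
   [u'] in [A1].  For [A <> A1], at most [n.+1] values of [g n] put [z_n] into
   [span (z_0, .., z_(n-1)) + A] once [n] passes the finite intersection of [A]
   with [A1], so that eventual difference suffices to avoid them all. *)
Lemma pos_not_mad X T (W : Type) (P : set W) (en : W -> nat -> nat -> E) :
  pos X T -> evdiff_small P ->
  (forall A D, cA A -> in_part X T D -> (forall n, bspan A (D n)) ->
     exists w m, P w /\ en w m = A) ->
  exists2 B, in_part X T B & forall A, cA A -> ad (bspan B) (bspan A).
Proof.
move=> pT smP cov; apply: contrapT => none.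
have nad_ex D : in_part X T D -> exists2 A, cA A & ~ ad (bspan D) (bspan A).
  move=> zD; apply: contrapT => H; apply: none; exists D => // A cAA.
  by apply: contrapT => nad; apply: H; exists A.
have sub_ex D A : in_part X T D -> ~ ad (bspan D) (bspan A) ->
    exists2 U, in_part X T U & forall n, bspan A (U n).
  move=> zD nad; have [U bU UP] := nad_blk coP nad.
  exists U; last by move=> n; case: (UP n).
  by apply: (in_part_sub coP zD bU) => n; case: (UP n).
have [D0 zD0 _] : exists2 D, in_part X T D & forall A, A \in [::] -> ad (bspan D) (bspan A).
  by apply: pT.
have [A0 cA0 nadD0] := nad_ex _ zD0.
have [U [bU UP] UA0] := sub_ex _ _ zD0 nadD0.
have [D1 zD1 adD1] : exists2 D, in_part X T D & forall A, A \in [:: A0] -> ad (bspan D) (bspan A).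
  by apply: pT => A; rewrite inE => /eqP ->.
have [A1 cA1 nadD1] := nad_ex _ zD1.
have A10 : A1 <> A0 by move=> e; apply: nadD1; rewrite e; apply: adD1; rewrite mem_head.
have [U' [bU' UP'] UA1] := sub_ex _ _ zD1 nadD1.
(* Far out, [U] leaves <A1> + span(h), which is almost disjoint from [A0]. *)
have /choice[p pP] : forall h, exists p,
    (exists N, (forall y, y \in h -> supp_lt N y) /\ supp_ge N (U p)) /\
    ~ adjoins (bspan A1) h (U p).
  move=> h; have [N NP] := supp_lt_seq coP h.
  have [M MP] : ad (adjoins (bspan A1) h) (bspan A0).
    by apply: ad_adjoins => //; try exact: bspan_closed; apply: cA_ad.
  have ge : supp_ge (maxn M N) (U (maxn M N)) by apply: blk_supp_ge_id.
  exists (maxn M N); split.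
    by exists N; split => //; apply: supp_geW ge; exact: leq_maxr.
  move=> inA; apply: (bU.1 (maxn M N)); apply: MP => //.
  by apply: supp_geW ge; exact: leq_maxl.
(* Terms of [U'] from [q h] on do not change the minimum of the support of [U (p h)];
   [size h <= q h] later pushes them past the intersection of [A] with [A1]. *)
have /choice[q qP] : forall h, exists q, size h <= q /\ supp_lt q (U (p h)).
  move=> h; have [N NP] := co_fin coP (U (p h)).
  exists (maxn (size h) N); rewrite leq_maxl; split => //.
  by apply: supp_ltW NP; exact: leq_maxr.
have U'ge h j : supp_ge (q h) (U' (q h + j)).
  by apply: supp_geW (leq_addr j (q h)) _; apply: blk_supp_ge_id.
pose cand h j := (U (p h) + U' (q h + j))%R.
have ms_lt h : ms (U (p h)) < q h.
  have [c _] := msP coP (bU.1 (p h)); rewrite ltnNge; apply/negP => le.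
  by apply: c; apply: (qP h).2.
have candms h j : ms (cand h j) = ms (U (p h)).
  have [c t] := msP coP (bU.1 (p h)); apply: ms_eq => //.
  - move=> n nlt; rewrite (coD coP) t // (U'ge h j) ?addr0 //.
    exact: ltn_trans nlt (ms_lt h).
  - by rewrite (coD coP) (U'ge h j) ?addr0.
have cand0 h j : cand h j <> 0%R.
  have [c _] := msP coP (bU.1 (p h)) => e; apply: c.
  have := coD coP (U (p h)) (U' (q h + j)) (ms (U (p h))).
  by rewrite -/(cand h j) e (co0 coP) (U'ge h j) ?addr0.
pose bad A h j := adjoins (bspan A) h (cand h j).
pose goodJ A h J := size J = (size h).+1 /\ forall j, bad A h j -> j \in J.
have /choice[Jf JfP] : forall Ah : (nat -> E) * seq E, exists J, (exists J0, goodJ Ah.1 Ah.2 J0) -> goodJ Ah.1 Ah.2 J.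
  move=> [A h] /=; have [[J0 ?]|] := pselect (exists J0, goodJ A h J0); first by exists J0.
  by move=> ?; exists [::].
(* The guess numbered [pickle (m, i)] is entry [i] of the list of bad values for the member
   [en w m]; [cs] admits [m] and [i] up to [size h]. *)
pose b w k h := if unpickle k is Some (m, i) then nth 0 (Jf (en w m, h)) i else 0.
pose cs h := [seq pickle (m, i) | m <- iota 0 (size h : nat).+1, i <- iota 0 (size (h : seq E)).+1].
pose hcode (h : seq E) := pickle (map code h).
have hcode_inj : injective hcode.
  move=> h h' /(pcan_inj (@pickleK _)); exact: inj_map.
have [g gP] := evdiff_slalom cs b hcode_inj smP.
have [|Z bZ ZP] := @blk_select_next _ _ co (fun h x => x = cand h (g h)).
  move=> h; exists (cand h (g h)); split=> //.
  have [[N [Nh NU]] _] := pP h; exists N; split=> // n nN.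
  rewrite (coD coP) NU // (U'ge h _ n) ?addr0 //.
  apply: ltn_trans (ms_lt h); apply: leq_trans nN _.
  by apply: ms_ge => //; exact: bU.1.
have zZ : in_part X T Z.
  split=> // n; rewrite ZP; split.
    apply: lclosedD; first exact: bspan_closed.
      by case: (UP (p (mkseq Z n))).
    by case: (UP' (q (mkseq Z n) + g (mkseq Z n))).
  by rewrite candms; case: (UP (p (mkseq Z n))).
apply: none; exists Z => // A cAA.
have [->|AA1] := pselect (A = A1).
  apply: (@ad_of_notin _ _ _ coP _ _ 0) => //; first exact: bspan_closed.
  move=> n _; rewrite ZP => inA; have [_] := pP (mkseq Z n); apply.
  have cl := adjoins_closed (mkseq Z n) (bspan_closed A1).
  rewrite -[U _](addrK (U' (q (mkseq Z n) + g (mkseq Z n)))).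
  apply: lclosedB => //; elim: (mkseq Z n) {inA cl} (U' _) (UA1 (q (mkseq Z n) + g (mkseq Z n))) => //= v h IH x Ax.
  by exists 0%R; rewrite scale0r subr0; apply: IH.
apply: contrapT => nad.
have [D zD DA] := sub_ex _ _ zZ nad.
have [w [m [Pw enA]]] := cov A D cAA zD DA.
have [NA NAP] := cA_ad cA1 cAA (nesym AA1).
have [Nw NwP] := gP w Pw.
have [|N NP] := @injective_unbounded (fun n => hcode (mkseq Z n)) _ Nw.
  by move=> i j /hcode_inj /(congr1 size); rewrite !size_mkseq.
(* Past [N] the guesses are wrong, past [NA] the spans of [A] and [A1] meet trivially, and from [m]
   on the number [m] is among those that [cs] admits. *)
apply: nad; apply: (@ad_of_notin _ _ _ coP _ _ (maxn N (maxn NA m))) => //; first exact: bspan_closed.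
move=> n; rewrite !geq_max => /and3P[Nn NAn mn]; rewrite ZP => badA.
move: (NP n Nn); rewrite leqNgt => /negP; apply.
set h := mkseq Z n in badA *; have hn : size h = n by rewrite size_mkseq.
have ind0 : indep_mod (bspan A) (fun j => U' (q h + j)) [::].
  move=> k l _ inA.
  have s0 : (\sum_(j < k) l j *: U' (q h + j))%R = 0%R.
    apply: NAP => //.
      by apply: lclosed_sum; [exact: bspan_closed|move=> i; exact: UA1].
    apply: (lclosed_sum _ (supp_ge_closed coP NA)) => i; apply: supp_geW (U'ge h i).
    by apply: leq_trans NAn _; rewrite -hn; case: (qP h).
  apply: (blk_indep (B := fun j => U' (q h + j)) coP _ s0).
  by apply: (@blk_sub _ _ co U' (addn (q h))) => // i j ij; rewrite ltn_add2l.
(* [U (p h)] is adjoined along with [h], since a bad [j] puts [U' (q h + j)] into <A> + span(U (p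
   h), h). *)
have [J sJ indJ] := indep_mod_adjoins (U (p h) :: h) (bspan_closed A) ind0.
have gJ : goodJ A h J.
  split=> // j badj; apply: contrapT => /negP jJ.
  apply: (indep_mod_notin indJ jJ); exists (-1)%R.
  by rewrite scaleN1r opprK addrC.
have [sJf JfA] := JfP (A, h) (ex_intro _ J gJ).
have gin := JfA _ badA.
apply: (NwP h (pickle (m, index (g h) (Jf (A, h))))).
  apply/allpairsP; exists (m, index (g h) (Jf (A, h))); rewrite !mem_iota /= !add0n; split=> //.
    by rewrite ltnS hn.
  by rewrite -sJf index_mem.
by rewrite /b pickleK enA nth_index.
Qed.

End NotMad.

(** * The next stage, along a branch that no earlier stage follows *)

Lemma first_difference (f f' : nat -> bool) : f <> f' ->
  exists2 n, f n != f' n & forall m, m < n -> f m = f' m.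
Proof.
move=> ff'; have ex : exists n, f n != f' n.
  apply: contrapT => H; apply: ff'; apply: funext => n.
  by apply: contrapT => /eqP e; apply: H; exists n.
case: (ex_minnP ex) => n fn nmin; exists n => // m mn.
by apply: contrapT => /eqP /nmin; rewrite leqNgt mn.
Qed.

Section Stage.
Variables (F : fieldType) (E : lmodType F) (co : E -> nat -> F).
Hypothesis coP : coordinates co.
Variable code : E -> nat.
Hypothesis code_inj : injective code.
Variables (W : Type) (lt : W -> W -> Prop) (S : W -> set nat).
Hypothesis wo : strict_wo lt.
Hypothesis S_splits : forall M : nat -> set nat,
  (forall k N, exists2 x, N <= x & M k x) ->
  exists w, forall k N (l : bool), exists x, [/\ N <= x, M k x & S w x <-> l].
Hypothesis seg_small : forall w, evdiff_small [set w' | lt w' w].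
Implicit Types (X A B D : nat -> E) (T : set nat) (s : seq (nat -> E)).
Local Notation ad := (ad co).
Local Notation ms := (ms co).
Local Notation blk := (blk co).
Local Notation in_part := (in_part co).
Local Notation side := (side S).

Definition decides B w l := exists N, forall n, N <= n -> side w l (ms (B n)).

Lemma decides_sub B D w l : blk B -> blk D -> (forall n, bspan B (D n)) ->
  decides B w l -> decides D w l.
Proof.
move=> bB bD BD [N NP]; exists N => n Nn.
by have [k nk ->] := blk_sub_ms coP bB bD BD n; apply: NP; apply: leq_trans nk.
Qed.

Lemma side_uniq w l l' x : side w l x -> side w l' x -> l = l'.
Proof. by rewrite /side /=; case: l; case: l' => -[a b] [c d] //; exfalso; auto. Qed.

Lemma pos_almost_sub cA X T T' : (exists N, forall x, N <= x -> T x -> T' x) ->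
  pos co cA X T -> pos co cA X T'.
Proof.
move=> [N NP] pT s /pT[D [bD DP] adD].
exists (fun n => D (n + N)).
  split; first by apply: (@blk_sub _ _ co D (addn^~ N)) => // m n mn; rewrite ltn_add2r.
  move=> n; have [? ?] := DP (n + N); split=> //; apply: NP => //.
  by apply: leq_trans (blk_ms_ge coP _ bD); exact: leq_addl.
by move=> A /adD; apply: adS => //; exact: bspan_sub.
Qed.

(** Each earlier stage [g] has a node of length [beta g] in a binary tree, given by the sides that
    [Bs g] decides. [Bs_sep] makes nodes of equal length differ. *)
Variables (G : Type) (beta : G -> W) (Bs : G -> nat -> E) (As : G -> nat -> nat -> E).
Let cA : set (nat -> E) := [set A | exists g i, A = As g i].
Hypothesis cA_ad : forall A B, cA A -> cA B -> A <> B -> ad (bspan A) (bspan B).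
Hypothesis Bs_blk : forall g, blk (Bs g).
Hypothesis As_sub : forall g i n, bspan (Bs g) (As g i n).
Hypothesis Bs_dec : forall g w, lt w (beta g) -> exists l, decides (Bs g) w l.
Hypothesis Bs_sep : forall g g', g <> g' -> beta g = beta g' ->
  exists w l, [/\ lt w (beta g), decides (Bs g) w l & decides (Bs g') w (~~ l)].
Hypothesis G_small : ~ exists i : (nat -> bool) -> G, injective i.
Local Notation pos := (pos co cA).

(** Splitting [X] repeatedly at the least possible [w] gives a tree of positive parts. Let [b] be
    the least splitter of the pseudo-intersection along a free branch. The members that matter come
    from stages of rank below [b], at most one per rank, or from finite lists attached to [(w, l)]
    with [w] below [b], so [pos_not_mad] applies. *)
Lemma next_stage X : pos X setT ->
  exists b B, [/\ blk B, forall n, bspan X (B n),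
    forall A, cA A -> ad (bspan B) (bspan A),
    forall w, lt w b -> exists l, decides B w l
  & forall g, ~ lt (beta g) b ->
      exists w l, [/\ lt w b, decides (Bs g) w l & decides B w (~~ l)]].
Proof.
move=> posX.
pose split T w := forall l, pos X (T `&` side w l).
have /choice[sw swP] : forall T, exists w, pos X T ->
    split T w /\ forall w', lt w' w -> ~ split T w'.
  move=> T; have [pT|npT] := pselect (pos X T); last first.
    by have [w _] := pos_split coP cA_ad S_splits posX; exists w.
  have [w sT mT] := swo_min wo (P := split T) (pos_split coP cA_ad S_splits pT).
  by exists w => _; split=> // w' w'w /mT; apply.
pose Tn (f : nat -> bool) := fix Tn n : set nat :=
  if n is n'.+1 then Tn n' `&` side (sw (Tn n')) (f n') else setT.
have Tn_pos f n : pos X (Tn f n).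
  by elim: n => // n IH /=; have [sT _] := swP _ IH; apply: sT.
have Tn_dec f m n : m <= n -> Tn f n `<=` Tn f m.
  move=> /subnK <-; elim: (n - m) => // k IH x /= [Tx _]; exact: IH.
have /choice[Tf TfP] : forall f, exists T,
    (forall n, exists N, forall x, N <= x -> T x -> Tn f n x) /\ pos X T.
  move=> f; have [T ? ?] := pos_pseudo_intersection coP cA_ad (Tn_dec f) (Tn_pos f).
  by exists T.
have Tf_side f n l : pos X (Tf f `&` side (sw (Tn f n)) l) -> l = f n.
  move=> /(_ [::])[//|D [bD DP] _].
  have [N NP] := (TfP f).1 n.+1; have [_ [TD sD]] := DP N.
  have [_] := NP _ (blk_ms_ge coP _ bD) TD; exact: side_uniq.
(* Equality fails because [Tf f] lies almost on one side of [sw (Tn f n)]; a smaller [sw (Tf f)]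
   would already split [Tn f n], which almost contains [Tf f]. *)
have Tf_lt f n : lt (sw (Tn f n)) (sw (Tf f)).
  have [sT _] := swP _ (TfP f).2.
  case: (swo_total wo (sw (Tn f n)) (sw (Tf f))) => // h; exfalso.
    by have := Tf_side f n (~~ f n); rewrite h => /(_ (sT _)); case: (f n).
  have [_ /(_ _ h)] := swP _ (Tn_pos f n); apply => l.
  apply: pos_almost_sub (sT l); have [N NP] := (TfP f).1 n.
  by exists N => x Nx [Tx sx]; split=> //; apply: NP.
(* The node of [g] agrees with the branch [f] as far as both reach. *)
pose nonconf f g := forall w l, lt w (sw (Tf f)) -> lt w (beta g) ->
  decides (Bs g) w l -> pos X (Tf f `&` side w l).
(* Otherwise each branch f is followed by some g whose node extends it, and
   distinct branches are followed by distinct g's. *)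
have [f fP] : exists f, forall g, ~ lt (beta g) (sw (Tf f)) -> ~ nonconf f g.
  apply: contrapT => H.
  have /choice[i iP] : forall f, exists g, ~ lt (beta g) (sw (Tf f)) /\ nonconf f g.
    move=> f; apply: contrapT => H'; apply: H; exists f => g ? ?.
    by apply: H'; exists g.
  apply: G_small; exists i => f f' e; apply: contrapT => /first_difference[n fn fm].
  have TnE m : m <= n -> Tn f m = Tn f' m.
    by elim: m => // m IH mn /=; rewrite IH ?(ltnW mn) // fm.
  have [b1 c1] := iP f; have [b2 c2] := iP f'; rewrite -e in b2 c2.
  have v1 := Tf_lt f n; have v2 := Tf_lt f' n; rewrite -TnE // in v2.
  have vg : lt (sw (Tn f n)) (beta (i f)).
    by case: (swo_total wo (beta (i f)) (sw (Tf f))) => // [->//|]; apply: (swo_trans wo).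
  have [l dl] := Bs_dec vg.
  have l1 := Tf_side _ _ _ (c1 _ _ v1 vg dl).
  have := c2 _ _ v2 vg dl; rewrite TnE // => /Tf_side l2.
  by move: fn; rewrite -l1 -l2 eqxx.
pose T := Tf f; pose b := sw T; rewrite -/T -/b in fP.
have pT : pos X T := (TfP f).2.
have [_ bmin] := swP _ pT.
(* For a non-positive side of [T], [sl] is a finite list of members such that every block sequence
   in that side is compatible with one of them. *)
have /choice[sl slP] : forall wl : W * bool, exists s, ~ pos X (T `&` side wl.1 wl.2) ->
    (forall A, A \in s -> cA A) /\ forall D, in_part X (T `&` side wl.1 wl.2) D ->
      exists2 A, A \in s & ~ ad (bspan D) (bspan A).
  move=> [w l] /=; have [[s sP]|H] := pselect (exists s, (forall A, A \in s -> cA A) /\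
      forall D, in_part X (T `&` side w l) D -> exists2 A, A \in s & ~ ad (bspan D) (bspan A)).
    by exists s.
  exists [::] => np; exfalso; apply: np => s sA; apply: contrapT => H'; apply: H.
  exists s; split=> // D zD; apply: contrapT => H2; apply: H'; exists D => // A As'.
  by apply: contrapT => nad; apply: H2; exists A.
have /choice[en enP] : forall w, exists e : nat -> nat -> E, lt w b ->
    (forall g i, nonconf f g -> beta g = w -> exists m, e m = As g i) /\
    (forall l A, A \in sl (w, l) -> exists m, e m = A).
  move=> w; pose L := sl (w, true) ++ sl (w, false).
  have LP l A : A \in sl (w, l) -> A \in L.
    by case: l => Al; rewrite mem_cat Al ?orbT.
  have [[g0 [nc0 bg0]]|H] := pselect (exists g, nonconf f g /\ beta g = w); last first.
    exists (nth 0%R L) => _; split=> [g i nc bg|l A /LP AL]; first by case: H; exists g.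
    by exists (index A L); rewrite nth_index.
  exists (fun m => if odd m then nth 0%R L m./2 else As g0 m./2) => wb; split.
    move=> g i nc bg; exists i.*2; rewrite odd_double doubleK.
    suff -> : g = g0 by [].
    (* Two agreeing stages of the same rank would differ at some [w'] below [b] and make both sides
       of [w'] positive, against the minimality of [b]. *)
    apply: contrapT => /Bs_sep[|w' [l [w'w dg dg0]]]; first by rewrite bg bg0.
    rewrite bg in w'w; have w'b := swo_trans wo w'w wb.
    apply: (bmin w' w'b) => l'.
    have w'g : lt w' (beta g) by rewrite bg.
    have w'g0 : lt w' (beta g0) by rewrite bg0.
    have p1 := nc _ _ w'b w'g dg; have p2 := nc0 _ _ w'b w'g0 dg0.
    have [->|ll'] := eqVneq l' l; first exact: p1.
    by have -> : l' = ~~ l by move: ll'; case: (l'); case: (l).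
  by move=> l A /LP AL; exists (index A L).*2.+1; rewrite /= odd_double uphalf_double nth_index.
have [] := pos_not_mad coP code_inj cA_ad (en := en) pT (seg_small b).
  move=> A D [g [i ->]] zD DA.
  have [nc|cf] := pselect (nonconf f g).
    have gb : lt (beta g) b by apply: contrapT => /fP.
    have [m] := (enP _ gb).1 g i nc erefl; by exists (beta g), m.
  have [w [l [wb wg dg np]]] : exists w l, [/\ lt w b, lt w (beta g),
      decides (Bs g) w l & ~ pos X (T `&` side w l)].
    apply: contrapT => H; apply: cf => w l wb wg dg; apply: contrapT => np.
    by apply: H; exists w, l.
  have [slA sln] := slP (w, l) np.
  have bD := zD.1.
  have DB n : bspan (Bs g) (D n).
    by apply: (bspan_le (D := Bs g)) (DA n); exact: As_sub.
  have [N NP] := decides_sub (Bs_blk g) bD DB dg.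
  have [|A' A's nad] := sln (fun n => D (n + N)).
    split; first by apply: (@blk_sub _ _ co D (addn^~ N)) => // p q pq; rewrite ltn_add2r.
    move=> n; have [? ?] := zD.2 (n + N); split=> //; split=> //; apply: NP; exact: leq_addl.
  (* [D] runs inside [As g i], so a member compatible with its tail can only be [As g i]. *)
  have AA' : A' = As g i.
    apply: contrapT => ne; apply: nad.
    apply: adS (cA_ad (A := As g i) _ (slA _ A's) (nesym ne)) => //; last by exists g, i.
    by apply: bspan_le => n; exact: DA.
  have [m em] := (enP _ wb).2 l _ A's; exists w, m; split=> //; by rewrite em.
move=> B zB adB; have [bB BP] := zB.
(* [B] is almost disjoint from every member, so a side that it visits infinitely often is positive;
   by minimality of [b] it decides each [w] below [b]. *)
have posB w l : (forall N, exists2 n, N <= n & side w l (ms (B n))) -> pos X (T `&` side w l).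
  move=> /increasing_selection[phi mono phiP] s sA.
  exists (fun n => B (phi n)).
    split; first exact: blk_sub.
    by move=> n; have [? ?] := BP (phi n); split=> //; split=> //; exact: phiP.
  by move=> A /sA /adB; apply: adS => //; exact: bspan_sub.
have nodec w l : ~ decides B w l -> pos X (T `&` side w (~~ l)).
  move=> nd; apply: posB => N; apply: contrapT => H; apply: nd; exists N => n Nn.
  apply: contrapT => ns; apply: H; exists n => //; move: ns; rewrite /side /=.
  have [h|h] := pselect (S w (ms (B n))); case: (l) => /= ns.
  - by case: ns.
  - by split.
  - by split.
  - by case: ns.
have decB w : lt w b -> exists l, decides B w l.
  move=> wb; apply: contrapT => H; apply: (bmin w wb) => l; rewrite -(negbK l).
  by apply: nodec => d; apply: H; exists (~~ l).
exists b, B; split=> //; first by move=> n; case: (BP n).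
move=> g /fP nc.
have [w [l [wb wg dg np]]] : exists w l, [/\ lt w b, lt w (beta g),
    decides (Bs g) w l & ~ pos X (T `&` side w l)].
  apply: contrapT => H; apply: nc => w l wb wg dg; apply: contrapT => np.
  by apply: H; exists w, l.
exists w, l; split=> //.
have [l' [N NP]] := decB w wb.
have [ll|ne] := eqVneq l' l.
  by case: np; apply: posB => M; exists (maxn M N); rewrite ?leq_maxl // -ll; apply: NP; rewrite leq_maxr.
by exists N => n /NP; have -> : l' = ~~ l by move: ne; case: (l'); case: (l).
Qed.

End Stage.

(** * Hamel bases *)

Section Basis.
Local Open Scope ring_scope.
Variables (F : fieldType) (E : lmodType F) (e : nat -> E).
Hypothesis he : hamel_basis e.

Lemma expansion_ex x : exists l, expansion e x l.
Proof.
have : bspan e x by have := he.2; rewrite /bspan => ->.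
move=> /bspanP[n [c ->]]; exists (fun i => if (i < n)%N then c i else 0), n.
split; first by move=> i; rewrite ltnNge => ->.
by apply: eq_bigr => i _; rewrite ltn_ord.
Qed.

Lemma expansion_widen x l N M : (N <= M)%N -> (forall n, (N <= n)%N -> l n = 0) ->
  x = \sum_(n < N) l n *: e n -> x = \sum_(n < M) l n *: e n.
Proof.
move=> NM l0 ->; rewrite (sum_ord_widen _ _ NM); apply: eq_bigr => i _.
by case: ltnP => // /l0 ->.
Qed.

Lemma expansion_lin a x y l k : expansion e x l -> expansion e y k ->
  expansion e (a *: x + y) (fun n => a * l n + k n).
Proof.
move=> [N [lN xE]] [M [kM yE]]; exists (maxn N M); split.
  by move=> n; rewrite geq_max => /andP[/lN -> /kM ->]; rewrite mulr0 addr0.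
rewrite (expansion_widen (leq_maxl N M) lN xE) (expansion_widen (leq_maxr N M) kM yE).
rewrite scaler_sumr -big_split /=; apply: eq_bigr => i _.
by rewrite scalerDl scalerA.
Qed.

Lemma expansion_uniq x l k : expansion e x l -> expansion e x k -> l = k.
Proof.
move=> xl xk; have [N [N0 NE]] := expansion_lin (-1) xl xk.
apply: funext => n; case: (ltnP n N) => nN; last first.
  by move: (N0 n nN); rewrite mulN1r addrC => /eqP; rewrite subr_eq0 => /eqP.
have := he.1 N (fun i => -1 * l i + k i).
rewrite -NE scaleN1r addNr => /(_ erefl (Ordinal nN)) /=.
by rewrite mulN1r addrC => /eqP; rewrite subr_eq0 => /eqP.
Qed.

Lemma basis_coordinates : exists2 co : E -> nat -> F, coordinates co &
  forall x, expansion e x (co x).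
Proof.
have [co coE] := choice expansion_ex; exists co => //; split.
- move=> a x y n; suff -> : co (a *: x + y) = (fun n => a * co x n + co y n) by [].
  by apply: expansion_uniq (coE _) _; exact: expansion_lin.
- by move=> x; have [N [N0 _]] := coE x; exists N.
- move=> x x0; have [N [_ ->]] := coE x; rewrite big1 // => i _.
  by rewrite x0 scale0r.
Qed.

Variable co : E -> nat -> F.
Hypothesis coP : coordinates co.
Hypothesis coE : forall x, expansion e x (co x).

Lemma suppE x n : supp e x n <-> co x n <> 0.
Proof.
split; first by move=> [l xl /eqP ln]; rewrite (expansion_uniq (coE x) xl).
by move=> /eqP xn; exists (co x).
Qed.

Lemma basis_blk : blk co e.
Proof.
have eE n : co (e n) = (fun k => (k == n)%:R).
  apply: expansion_uniq (coE _) _; exists n.+1; split.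
    by move=> k nk; rewrite gtn_eqF.
  rewrite big_ord_recr /= eqxx scale1r big1 ?add0r // => i _.
  by rewrite ltn_eqF ?scale0r.
split=> [n e0|m n mn].
  have := eE n; rewrite e0 => /(congr1 (fun f => f n)).
  by rewrite co0 // eqxx => /esym/eqP; rewrite oner_eq0.
exists n; split=> k kn; rewrite eE.
- by rewrite gtn_eqF // (leq_trans mn).
- by rewrite ltn_eqF.
Qed.

Lemma block_seqsP B : block_seqs e B <-> blk co B.
Proof.
split=> [[B0 Blt]|[B0 Blt]].
  split=> [n|m n mn]; first exact/eqP.
  have [p [q [[_ pmax] [_ qmin] pq]]] := Blt _ _ mn.
  exists p.+1; split=> k kp; apply: contrapT => /suppE.
  - by move=> /pmax; rewrite leqNgt kp.
  - by move=> /qmin; rewrite leqNgt (leq_trans kp pq).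
split=> [n|m n mn]; first exact/eqP.
have [N [lN gN]] := Blt _ _ mn.
have ex : exists k, co (B m) k != 0.
  by have [/eqP ? _] := msP coP (B0 m); exists (ms co (B m)).
have ub k : co (B m) k != 0 -> (k <= N)%N.
  by move=> /eqP k0; rewrite leqNgt; apply/negP => /ltnW /lN.
case: (ex_maxnP ex ub) => p /eqP p0 pmax.
have [n0 nge] := msP coP (B0 n).
exists p, (ms co (B n)); split.
- by split; [exact/suppE|move=> k /suppE/eqP; exact: pmax].
- split; first exact/suppE.
  by move=> k /suppE k0; rewrite leqNgt; apply/negP => /nge.
- apply: leq_trans (ms_ge coP (B0 n) gN).
  by rewrite ltnNge; apply/negP => /lN.
Qed.

Lemma basis_countable : countable [set: F] -> exists code : E -> nat, injective code.
Proof.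
move=> /countable_injP[cF cF_inj].
have cFi x y : cF x = cF y -> x = y by apply: cF_inj; rewrite inE.
have [N NP] := choice (co_fin coP).
exists (fun x => pickle [seq cF (co x n) | n <- iota 0 (N x)]) => x y.
move=> /(pcan_inj (@pickleK _)) E_xy.
have NE : N x = N y by move: (congr1 size E_xy); rewrite !size_map !size_iota.
apply/eqP; rewrite -subr_eq0; apply/eqP; apply: (co_inj coP) => n.
apply/eqP; rewrite coB // subr_eq0; apply/eqP.
case: (leqP (N x) n) => nN; first by rewrite !NP // -NE.
move: (congr1 (fun s => nth 0%N s n) E_xy).
by rewrite !(nth_map 0%N) ?size_iota -?NE // !nth_iota -?NE // => /cFi.
Qed.

End Basis.

(** * Infinite sets, partitions of a block sequence, enumeration of the pairs *)

Lemma infinite_of_inj (U : eqType) (A : set U) (f : nat -> U) :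
  injective f -> (forall n, A (f n)) -> infinite_set A.
Proof.
move=> finj Af /finite_seqP[s sE].
have sub : {subset mkseq f (size s).+1 <= s}.
  by move=> _ /mapP[n _ ->]; have := Af n; rewrite sE.
by have := uniq_leq_size (mkseq_uniq _ finj) sub; rewrite size_mkseq ltnn.
Qed.

Lemma infinite_notin (U : eqType) (A : set U) (s : seq U) :
  infinite_set A -> exists2 x, A x & x \notin s.
Proof.
move=> infA; apply: contrapT => H; apply: infA.
apply: sub_finite_set (finite_seq s) => x Ax /=.
by apply: contrapT => /negP xs; apply: H; exists x.
Qed.

Section Partition.
Variables (F : fieldType) (E : lmodType F) (co : E -> nat -> F).
Hypothesis coP : coordinates co.

(** Piece [i] keeps the indices of 2-adic valuation [i]. A nonzero vector common to two pieces would
    have its support minimum at a term of each, hence at one index. *)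
Lemma blk_partition (B : nat -> E) : blk co B -> exists A : nat -> nat -> E,
  [/\ forall i, blk co (A i), forall i n, bspan B (A i n)
    & forall i j, i <> j -> ad co (bspan (A i)) (bspan (A j))].
Proof.
move=> bB; pose p i n := n.*2.+1 * 2 ^ i.
have bA i : blk co (fun n => B (p i n)).
  apply: blk_sub => // m n mn; rewrite /p ltn_pmul2r ?expn_gt0 //.
  by rewrite ltnS ltn_double.
have pi i n : logn 2 (p i n) = i.
  by rewrite logn_Gauss ?pfactorK // coprime2n /= odd_double.
exists (fun i n => B (p i n)); split=> //; first by move=> i n; exact: bspan_term.
move=> i j ij; exists 0 => x xi xj _; apply: contrapT => x0.
have [n nE] := blk_span_ms coP (bA i) xi x0.
have [m mE] := blk_span_ms coP (bA j) xj x0.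
apply: ij; rewrite -(pi i n) -(pi j m); congr (logn 2).
have {mE} := mE; rewrite nE.
by case: (ltngtP (p i n) (p j m)) => // /(blk_ms_lt coP bB) + e; rewrite e ltnn.
Qed.

End Partition.

(** A minimal well-order into which the continuum injects enumerates the pairs, since [code] turns
    each pair into a subset of the naturals. *)
Lemma stages (E : Type) (e0 : E) (code : E -> nat) : injective code ->
  exists (W : Type) (lt : W -> W -> Prop) (pr : W -> set E * (nat -> E)),
    [/\ strict_wo lt, forall p, exists w, pr w = p
      & forall w, ~ exists i : (nat -> bool) -> W, injective i /\ forall f, lt (i f) w].
Proof.
move=> cinj.
pose bad (P : set (nat -> bool)) := exists i : (nat -> bool) -> (nat -> bool),
  injective i /\ forall f, P (i f).
have [|W [lt [k [wo kinj [i [iinj irange]] nbad]]]] := @minimal_bad_wo (nat -> bool) bad.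
  by exists id; split.
pose kap (p : set E * (nat -> E)) (n : nat) : bool :=
  match unpickle n : option (nat + nat * nat) with
  | Some (inl a) => `[< exists2 y, p.1 y & code y = a >]
  | Some (inr (j, a)) => code (p.2 j) == a
  | None => false
  end.
have kap_inj : injective kap.
  move=> [Y X] [Y' X'] eqk.
  have kl a : (exists2 y, Y y & code y = a) = (exists2 y, Y' y & code y = a).
    have := congr1 (fun f => f (pickle (inl a : nat + nat * nat))) eqk.
    by rewrite /kap pickleK /= => H; apply: propext; exact: asbool_eq_equiv.
  have -> : Y = Y'.
    apply/seteqP; split=> y Yy.
      have : exists2 z, Y z & code z = code y by exists y.
      by rewrite kl => -[z Yz /cinj <-].
    have : exists2 z, Y' z & code z = code y by exists y.
    by rewrite -kl => -[z Yz /cinj <-].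
  suff -> : X = X' by [].
  apply: funext => j.
  have := congr1 (fun f => f (pickle (inr (j, code (X j)) : nat + nat * nat))) eqk.
  by rewrite /kap pickleK /= eqxx => /esym/eqP/cinj.
exists W, lt, (fun w => if pselect (exists p, i (kap p) = k w) is left h
  then sval (cid h) else (set0, fun=> e0)); split=> //.
- move=> p; have [w _ wE] := irange (kap p); exists w.
  case: pselect => [h|]; last by case; exists p.
  by apply: kap_inj; apply: iinj; rewrite -wE; case: (cid h).
- move=> w [j [jinj jlt]]; apply: (nbad w); exists (k \o j); split.
    by move=> f f' /kinj/jinj.
  by move=> f; exists (j f) => //; exact: jlt.
Qed.

(** * The construction *)

Section Construction.
Variables (F : fieldType) (E : lmodType F) (co : E -> nat -> F).
Hypothesis coP : coordinates co.
Variable code : E -> nat.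
Hypothesis code_inj : injective code.
Variables (W : Type) (lt : W -> W -> Prop) (S : W -> set nat).
Hypothesis wo : strict_wo lt.
Hypothesis S_splits : forall M : nat -> set nat,
  (forall k N, exists2 x, N <= x & M k x) ->
  exists w, forall k N (l : bool), exists x, [/\ N <= x, M k x & S w x <-> l].
Hypothesis seg_small : forall w, evdiff_small [set w' | lt w' w].
Variables (I : Type) (ltI : I -> I -> Prop) (pr : I -> set E * (nat -> E)).
Hypothesis woI : strict_wo ltI.
Hypothesis I_small :
  forall t, ~ exists i : (nat -> bool) -> I, injective i /\ forall f, ltI (i f) t.
Local Notation ad := (ad co).
Local Notation blk := (blk co).
Local Notation decides := (decides co S).

Record stage := Stage { st_rank : W; st_blk : nat -> E; st_fam : nat -> nat -> E }.

(** [ok_dec] and [ok_sep] maintain the tree of nodes for [next_stage]; [ok_in] prepares fullness at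
    [(Y, X)]. *)
Record stage_ok (Y : set E) (X : nat -> E) (prev : set stage) (d : stage) : Prop := StageOk {
  ok_blk : blk (st_blk d);
  ok_le : forall n, bspan X (st_blk d n);
  ok_ad : forall d' i, prev d' -> ad (bspan (st_blk d)) (bspan (st_fam d' i));
  ok_dec : forall w, lt w (st_rank d) -> exists l, decides (st_blk d) w l;
  ok_sep : forall d', prev d' -> ~ lt (st_rank d') (st_rank d) -> exists w l,
    [/\ lt w (st_rank d), decides (st_blk d') w l & decides (st_blk d) w (~~ l)];
  ok_in : bspan (st_blk d) `<=` Y \/
    ~ exists C, [/\ blk C, forall n, bspan (st_blk d) (C n) & bspan C `<=` Y];
  ok_fam : forall i, blk (st_fam d i);
  ok_fam_le : forall i n, bspan (st_blk d) (st_fam d i n);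
  ok_fam_ad : forall i j, i <> j -> ad (bspan (st_fam d i)) (bspan (st_fam d j)) }.

(** A stage is skipped only when no valid [d] exists. By [next_stage] positivity then fails, and its
    failure is the finite list [s]. *)
Lemma stages_family : exists D : I -> option stage,
  (forall t d, D t = Some d -> stage_ok (pr t).1 (pr t).2
     [set d' | exists2 t', ltI t' t & D t' = Some d'] d) /\
  forall t, D t = None -> exists s : seq (nat -> E),
    (forall A, A \in s -> exists t' d i, D t' = Some d /\ A = st_fam d i) /\
    forall C, blk C -> (forall n, bspan (pr t).2 (C n)) ->
      exists2 A, A \in s & ~ ad (bspan C) (bspan A).
Proof.
pose ok t (D : I -> option stage) d :=
  stage_ok (pr t).1 (pr t).2 [set d' | exists t', D t' = Some d'] d.
have [D DE] := @swo_rec I ltI stage (fun t D =>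
  if pselect (exists d, ok t D d) is left h then Some (sval (cid h)) else None) woI.
pose prev t : set stage := [set d' | exists2 t', ltI t' t & D t' = Some d'].
have prevE t : [set d' | exists t', (if pselect (ltI t' t) then D t' else None) = Some d'] = prev t.
  apply/seteqP; split=> d; first by move=> [t']; case: pselect => // h e; exists t'.
  by move=> [t' h e]; exists t'; case: pselect.
have DS t d : D t = Some d -> stage_ok (pr t).1 (pr t).2 (prev t) d.
  rewrite DE; case: pselect => // h [<-]; case: (cid h) => d' /=.
  by rewrite /ok prevE.
exists D; split=> // t Dt.
have nok : ~ exists d, stage_ok (pr t).1 (pr t).2 (prev t) d.
  by move: Dt; rewrite DE; case: pselect => // h _; move: h; rewrite /ok prevE.
(* The earlier stages that succeeded; the continuum does not inject into them, as they embed into a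
   proper segment of [I]. *)
pose G := {p : I * stage | ltI p.1 t /\ D p.1 = Some p.2}.
pose st (g : G) := (sval g).2.
have Gok (g : G) : stage_ok (pr (sval g).1).1 (pr (sval g).1).2 (prev (sval g).1) (st g).
  by apply: DS; case: (svalP g).
have G_inj (g g' : G) : (sval g).1 = (sval g').1 -> g = g'.
  case: g => -[u d] [l1 e1]; case: g' => -[u' d'] [l2 e2] /= e; subst u'.
  have dd : d = d' by move: e1; rewrite /= e2 => -[->].
  by subst d'; congr exist; exact: Prop_irrelevance.
have later (g g' : G) : ltI (sval g).1 (sval g').1 -> prev (sval g').1 (st g).
  by move=> h; exists (sval g).1 => //; case: (svalP g).
pose cA : set (nat -> E) := [set A | exists g i, A = st_fam (st g) i].
have fam_ad (g g' : G) i i' : ltI (sval g).1 (sval g').1 ->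
    ad (bspan (st_fam (st g') i')) (bspan (st_fam (st g) i)).
  move=> h; apply: adS (ok_ad (Gok g') i (later _ _ h)) => //.
  exact: bspan_le (ok_fam_le (Gok g') i').
have cA_ad A B : cA A -> cA B -> A <> B -> ad (bspan A) (bspan B).
  move=> [g [i ->]] [g' [i' ->]] ne.
  case: (swo_total woI (sval g).1 (sval g').1) => h.
  - by apply: adC; apply: fam_ad.
  - have gg := G_inj _ _ h; subst g'; apply: (ok_fam_ad (Gok g)) => ii.
    by apply: ne; rewrite ii.
  - exact: fam_ad.
have G_sep (g g' : G) : g <> g' -> st_rank (st g) = st_rank (st g') ->
    exists w l, [/\ lt w (st_rank (st g)), decides (st_blk (st g)) w l
      & decides (st_blk (st g')) w (~~ l)].
  move=> ne re; case: (swo_total woI (sval g).1 (sval g').1) => h.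
  - have [|w [l [wl d1 d2]]] := ok_sep (Gok g') (later _ _ h).
      by rewrite re; exact: (swo_irr wo).
    by exists w, l; rewrite re.
  - by case: ne; apply: G_inj.
  - have [|w [l [wl d1 d2]]] := ok_sep (Gok g) (later _ _ h).
      by rewrite re; exact: (swo_irr wo).
    by exists w, (~~ l); rewrite negbK.
have G_small : ~ exists i : (nat -> bool) -> G, injective i.
  move=> [i iinj]; apply: (I_small (t := t)); exists (fun f => (sval (i f)).1); split.
    by move=> f f' /G_inj/iinj.
  by move=> f; case: (svalP (i f)).
have npos : ~ pos co cA (pr t).2 setT.
  move=> /(next_stage coP code_inj wo S_splits seg_small cA_ad
    (fun g => ok_blk (Gok g)) (fun g => ok_fam_le (Gok g))
    (fun g => ok_dec (Gok g)) G_sep G_small)[b [B [bB BX Bad Bdec Bsep]]].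
  have [B' [bB' B'B B'Y]] : exists B', [/\ blk B', forall n, bspan B (B' n) &
      bspan B' `<=` (pr t).1 \/
      ~ exists C, [/\ blk C, forall n, bspan B' (C n) & bspan C `<=` (pr t).1]].
    have [[C [bC CB CY]]|H] := pselect (exists C, [/\ blk C, forall n, bspan B (C n)
        & bspan C `<=` (pr t).1]).
      by exists C; split=> //; left.
    exists B; split=> //; first by move=> n; exact: bspan_term.
    by right.
  have [A [bA AB' Aad]] := blk_partition coP bB'.
  apply: nok; exists (Stage b B' A); split=> //=.
  - by move=> n; apply: (bspan_le BX) (B'B n).
  - move=> d' i [t' lt' Dt']; apply: (adS (bspan_le B'B) (@subset_refl _ _)).
    by apply: Bad; exists (exist _ (t', d') (conj lt' Dt')), i.
  - move=> w /Bdec[l dl]; exists l; exact: (decides_sub coP bB bB' B'B).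
  - move=> d' [t' lt' Dt'] nlt.
    have [w [l [wb d1 d2]]] := Bsep (exist _ (t', d') (conj lt' Dt')) nlt.
    by exists w, l; split=> //; exact: (decides_sub coP bB bB' B'B).
apply: contrapT => H; apply: npos => s sA; apply: contrapT => H'; apply: H.
exists s; split.
  move=> A /sA[g [i ->]]; exists (sval g).1, (st g), i; split=> //.
  by case: (svalP g).
move=> C bC CX; apply: contrapT => H2; apply: H'; exists C.
  by split=> // n; split.
by move=> A As'; apply: contrapT => nad; apply: H2; exists A.
Qed.

End Construction.

(* Mad families are infinite by the usual convention.  A finite family such as
   [set e] has an empty Hfam and would be full vacuously. *)
Theorem theorem1p5 (F : fieldType) (hF : countable [set: F])
    (E : lmodType F) (e : nat -> E) (he : hamel_basis e) :
  exists cA : set (nat -> E), infinite_set cA /\ full_mad_family e cA.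
Proof.
have [co coP coE] := basis_coordinates he.
have [code code_inj] := basis_countable coP hF.
have [W [lt [Fw [wo Fw_unb seg_small]]]] := evdiff_wo.
have [I [ltI [pr [woI pr_onto I_small]]]] := stages (e 0) code_inj.
have [D [DS DN]] := stages_family coP code_inj wo
  (fun M => spset_splits Fw_unb (M := M)) seg_small pr woI I_small.
have blkP B : block_seqs e B <-> blk co B by exact: block_seqsP.
pose cA : set (nat -> E) := [set A | exists t d i, D t = Some d /\ A = st_fam d i].
have fam_sub t d i : D t = Some d -> bspan (st_fam d i) `<=` bspan (st_blk d).
  by move=> /DS ok; apply: bspan_le => n; exact: (ok_fam_le ok).
have cA_ad A B : cA A -> cA B -> A <> B -> ad co (bspan A) (bspan B).
  have earlier t t' d d' i i' : ltI t t' -> D t = Some d -> D t' = Some d' ->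
      ad co (bspan (st_fam d' i')) (bspan (st_fam d i)).
    move=> tt' Dt Dt'; apply: (adS (fam_sub _ _ i' Dt') (@subset_refl _ _)).
    by apply: (ok_ad (DS _ _ Dt')); exists t.
  move=> [t [d [i [Dt ->]]]] [t' [d' [i' [Dt' ->]]]] ne.
  case: (swo_total woI t t') => h; [by apply: adC; apply: earlier h _ _| |exact: earlier h _ _].
  subst t'; move: Dt'; rewrite Dt => -[dd]; subst d'.
  by apply: (ok_fam_ad (DS _ _ Dt)) => ii; apply: ne; rewrite ii.
have fam_inj t d : D t = Some d -> injective (st_fam d).
  move=> Dt i j ij; apply: contrapT => /(ok_fam_ad (DS _ _ Dt)); rewrite ij.
  by apply: (blk_nad coP (ok_fam (DS _ _ Dt) j)) => n; exact: bspan_term.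
have active t Y X : pr t = (Y, X) -> D t = None ->
    exists2 s : seq (nat -> E), (forall A, A \in s -> cA A) &
    forall C, blk co C -> (forall n, bspan X (C n)) ->
      exists2 A, A \in s & ~ ad co (bspan C) (bspan A).
  by move=> tE /DN[s [sA sP]]; exists s => //; move: sP; rewrite tE.
have bterm (X : nat -> E) n : bspan X (X n) by exact: bspan_term.
(* The stage of [(set0, X)] either adds members below [X], or was skipped because finitely many
   members already dominate [X]. *)
have mad X : blk co X -> ~ (forall A, cA A -> ad co (bspan A) (bspan X)).
  move=> bX adX; have [t tE] := pr_onto (set0, X).
  case Dt : (D t) => [d|].
    have ok := DS _ _ Dt; rewrite tE in ok.
    apply: (blk_nad coP (ok_fam ok 0) (bterm _)) (adX (st_fam d 0) _).
      by move=> n; apply: (bspan_le (ok_le ok)); exact: (ok_fam_le ok).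
    by exists t, d, 0.
  have [s sA sP] := active _ _ _ tE Dt.
  have [A As] := sP X bX (bterm X); apply; apply: adC; apply: adX; exact: sA.
have inf t d (P : set (nat -> E)) : D t = Some d -> (forall i, P (st_fam d i)) ->
    infinite_set P.
  by move=> Dt; apply: infinite_of_inj; exact: fam_inj Dt.
exists cA; split; last split; first last.
- move=> Y X [/blkP bX infX] dense.
  have [t tE] := pr_onto (Y, X).
  case Dt : (D t) => [d|].
    have ok := DS _ _ Dt; rewrite tE /= in ok.
    (* The infinitely many pieces added at this stage put [st_blk d] into [Hfam]. *)
    have HB : restr (Hfam e cA) X (st_blk d).
      split; last exact: bspan_le (ok_le ok).
      split; first by apply/blkP; exact: ok_blk ok.
      apply: (inf t d) => // i; split; first by exists t, d, i.
      exists (st_fam d i); first by apply/blkP; exact: ok_fam ok i.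
      by move=> x xA; split=> //; apply: fam_sub Dt _ xA.
    (* Density applied to [st_blk d] excludes the second alternative of [ok_in]. *)
    exists (st_blk d) => //; case: (ok_in ok) => // nC; case: nC.
    have [C [/blkP bC CB CY]] := dense _ HB; exists C; split=> // n.
    by apply: CB; exact: bterm.
  have [s sA sP] := active _ _ _ tE Dt.
  (* A skipped stage contradicts [Hfam]: some [A] outside [s] shares a block subspace <C> with [X],
     yet [C] is compatible with a member of [s]. *)
  have [A [cAA [C /blkP bC CA]] As] := infinite_notin s infX.
  have [n|A' A's] := sP C bC; first by case: (CA _ (bterm C n)).
  case; apply: (adS _ (@subset_refl _ _) (cA_ad A A' cAA (sA _ A's) _)).
    by move=> x /CA[].
  by move=> AA'; move: As; rewrite AA' A's.
- split; last first.
    move=> [X /blkP bX adX]; apply: (mad X bX) => A cAA.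
    by apply/(almost_disjointP coP); exact: adX.
  split; first by move=> _ [t [d [i [Dt ->]]]]; apply/blkP; exact: (ok_fam (DS _ _ Dt)).
  by move=> A B cAA cAB ne; apply/(almost_disjointP coP); exact: cA_ad.
- have [_ [t [d [_ [Dt _]]]]] : exists A, cA A.
    apply: contrapT => H; apply: (mad e (basis_blk he coP coE)) => A cAA.
    by case: H; exists A.
  by apply: (inf t d) => // i; exists t, d, i.
Qed.
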